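(* There exist pairs of line arrangements in $\mathbb{P}^2=\mathbb{P}^2_{\mathbb{C}}$ possessing the same weak combinatorics such that one is free and the other is not.
   Context: A line arrangement $\mathcal{A}=\{l_1,\dots,l_n\}$ is a finite set of distinct lines in $\mathbb{P}^2$; let $f=\prod f_i$ be its defining equation. The sheaf $\mathcal{T}_{\mathcal{A}}$ (a rank 2 vector bundle) is defined by $$0\to \mathcal{T}_{\mathcal{A}}\to \mathcal{O}_{\mathbb{P}^2}^3\xrightarrow{\nabla f}\mathcal{J}_f(n-1)\to 0,$$ where $\mathcal{J}_f$ is the ideal sheaf generated by $\nabla f=(\partial_x f,\partial_y f,\partial_z f)$. The arrangement is free if $\mathcal{T}_{\mathcal{A}}\cong \mathcal{O}_{\mathbb{P}^2}(-\alpha)\oplus\mathcal{O}_{\mathbb{P}^2}(-\beta)$ for some integers $\alpha,\beta$. The weak combinatorics of an arrangement $\mathcal{A}$ of $n$ lines is the data of the integers $t_i$ for $2\le i\le n$, where $t_i$ is the number of points contained in exactly $i$ lines of $\mathcal{A}$. Two arrangements have the same weak combinatorics if they have the same number $n$ of lines and the same integers $t_i$ for all $2\le i\le n$. *)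

(* Defs.v *)
From HB Require Import structures.
From mathcomp Require Import all_boot all_order all_algebra finmap.
From mathcomp Require Import classical_sets functions cardinality reals.
From mathcomp Require Import complex mpoly.

Set Implicit Arguments.
Unset Strict Implicit.
Unset Printing Implicit Defensive.

Import GRing.Theory.
Local Open Scope ring_scope.
Local Open Scope complex_scope.
Local Open Scope classical_set_scope.

(* Points and lines of P^2 = P(C^3), with C = R[i], are the subspaces of C^3
   of dimension 1 and 2; a point p lies on a line l when (p <= l)%VS. *)

Section LineArrangements.
Variable R : realType.
Implicit Types A B : {fset {vspace 'rV[R[i]]_3}}.

Definition line_arrangement A : Prop := forall l, l \in A -> \dim l = 2%N.

Definition points_on_exactly A (i : nat) : set {vspace 'rV[R[i]]_3} :=
  [set p | \dim p = 1%N /\ #|` [fset l in A | (p <= l)%VS]%fset| = i].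

(* This set of points is finite when i >= 2, two distinct lines having a single
   common point; fset_set would return the empty set on an infinite set. *)
Definition t_ A (i : nat) : nat := #|` fset_set (points_on_exactly A i)|.

Definition same_weak_combinatorics A B : Prop :=
  #|` A| = #|` B| /\
  forall i : nat, (2 <= i <= #|` A|)%N -> t_ A i = t_ B i.

End LineArrangements.

(* Sheaves on P^2.  A subset of P^2 is given by its punctured cone in
   C^3 \ {0}.  Every sheaf below is a subsheaf of the sheaf of C^k-valued
   functions on punctured cones: it sends an open U to the set of its sections
   over U, a section being extended by 0 outside U so that equality of sections
   is equality of functions. *)

Section Sheaves.
Variable R : realType.
Local Notation C := R[i].
Local Notation V := 'rV[C]_3.

Definition evalv (p : {mpoly C[3]}) (v : V) : C := p.@[fun i => v 0 i].

Definition zariski_open (U : set V) : Prop :=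
  exists2 F : set {mpoly C[3]},
    (forall g, F g -> exists m : nat, g \is m.-homog) &
    U = [set v | v != 0 /\ exists2 g, F g & evalv g v != 0].

Definition restriction (k : nat) (U : set V) (s : V -> 'rV[C]_k) :
  V -> 'rV[C]_k := patch (fun=> 0) U s.

(* Sections of O(d) over U: functions that are locally quotients p / q of
   homogeneous polynomials with deg p - deg q = d. *)
Definition twisted_section (d : int) (U : set V) (s : V -> C) : Prop :=
  (forall v, ~ U v -> s v = 0) /\
  forall v, U v -> exists p q : {mpoly C[3]}, exists m e : nat,
    [/\ p \is m.-homog, q \is e.-homog, m%:Z = e%:Z + d, evalv q v != 0 &
        forall w, U w -> evalv q w != 0 -> s w = evalv p w / evalv q w].

Definition presheaf (k : nat) := set V -> set (V -> 'rV[C]_k).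

Definition sum_twists (a b : int) : presheaf 2 := fun U =>
  [set s | twisted_section a U (fun v => s v 0 0) /\
           twisted_section b U (fun v => s v 0 1)].

(* The kernel of grad f : O^3 -> O(deg f - 1).  The image of this map being
   J_f(deg f - 1), this is also the kernel of O^3 -> J_f(deg f - 1). *)
Definition jacobian_kernel (f : {mpoly C[3]}) : presheaf 3 := fun U =>
  [set s | (forall j, twisted_section 0 U (fun v => s v 0 j)) /\
           forall v, U v -> \sum_(j < 3) s v 0 j * evalv f^`M(j) v = 0].

(* Isomorphism of sheaves of modules over the structure sheaf O = O(0). *)
Definition module_iso (k m : nat) (F : presheaf k) (G : presheaf m) : Prop :=
  exists phi : set V -> (V -> 'rV[C]_k) -> (V -> 'rV[C]_m),
    [/\ (forall U, zariski_open U -> set_bij (F U) (G U) (phi U)),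
        (forall U, zariski_open U -> forall s t, F U s -> F U t ->
           phi U (fun v => s v + t v) = (fun v => phi U s v + phi U t v)),
        (forall U, zariski_open U -> forall a s,
           twisted_section 0 U a -> F U s ->
           phi U (fun v => a v *: s v) = (fun v => a v *: phi U s v)) &
        (forall U W, zariski_open U -> zariski_open W -> W `<=` U ->
           forall s, F U s ->
           phi W (restriction W s) = restriction W (phi U s))].

Definition line_equation (l : {vspace V}) (g : {mpoly C[3]}) : Prop :=
  [/\ g \is 1.-homog, g != 0 & forall v, v \in l -> evalv g v = 0].

Definition defining_equation (A : {fset {vspace V}}) (f : {mpoly C[3]}) :
    Prop :=
  exists2 g : {vspace V} -> {mpoly C[3]},
    (forall l, l \in A -> line_equation l (g l)) &
    f = \prod_(l <- A) g l.

(* The defining equation is unique up to a nonzero scalar, which does not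
   change the kernel. *)
Definition free_arrangement (A : {fset {vspace V}}) : Prop :=
  exists2 f, defining_equation A f &
    exists alpha beta : int,
      module_iso (jacobian_kernel f) (sum_twists (- alpha) (- beta)).

End Sheaves.

(* Main.v *)
(* The arrangements.  For a set S of four nonzero numbers take the 15 lines
   x = 0, y = 0, z = 0, x = c y, y = a z, x = d z with c, a, d in S.  The number
   of points on exactly i lines depends only on the number of triples with
   d = c a.  This number is 12 both for S = {1, -1, 2, -2} and for the set S of
   primitive fifth roots of unity.

   Freeness of the first.  Two syzygies of grad f of degree 7, whose determinant
   with the Euler field is a nonzero multiple of f, generate the kernel: the
   coefficients of a section on them are determinants divided by f, and these
   are regular because every section of the kernel is tangent to the 15 lines.

   Non-freeness of the second.  The field (x^6, y^6, z^6), corrected by a multiple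
   of the Euler field, is a syzygy psi of degree 6 vanishing at (1 : 1 : 1), which
   lies on no line, but nowhere on the line z = 0.  If the kernel were
   O(-alpha) + O(-beta), its generators t1, t2 would be independent off the lines,
   and their determinant with the Euler field would vanish on 15 lines, so that
   alpha + beta >= 14.  Write psi = a t1 + b t2 with, say, beta > 6: then b = 0, and
   a is a section of O(6 - alpha) vanishing at (1 : 1 : 1).  So a vanishes somewhere
   on z = 0, and psi vanishes there as well. *)

Require Import Defs.
From mathcomp Require Import all_boot all_order all_algebra finmap.
From mathcomp Require Import reals complex.
From mathcomp Require Import boolp classical_sets functions cardinality mpoly.
From mathcomp Require Import ring zify.

Set Implicit Arguments.
Unset Strict Implicit.
Unset Printing Implicit Defensive.

Import Order.TTheory GRing.Theory Num.Theory.
Local Open Scope ring_scope.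
Local Open Scope complex_scope.
Local Open Scope classical_set_scope.

(** * Forms on C^3 *)

(** On both sides 12 arises as 16 - 4: a product of two elements of {1, -1, 2, -2} leaves the set
    only if both factors are 2 or -2, a product of two primitive fifth roots only if it is 1. So
    both arrangements have t_6 = 3, t_3 = 12, t_2 = 24. A free arrangement with these numbers has
    exponents of sum 14 and product 14^2 - (3*25 + 12*4 + 24) = 49, that is 7 and 7; a syzygy of
    degree 6 is thus one degree too low. The proof avoids this computation of a second Chern class:
    the bound on alpha + beta suffices once the syzygy of degree 6 has a zero off the lines. The
    obstacle is that an isomorphism of sheaves is only a family of maps on sections over opens, and
    O(-alpha) has no nonzero global section when alpha > 0, so generators cannot be read off
    globally. They are transported on the charts x_i != 0, where x_i^(-alpha) generates O(-alpha),
    and glued after multiplication by x_i^alpha. Irreducibility of the plane enters only through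
    joining two points by a line and counting roots of univariate polynomials. *)

Section Forms.
Variable R : realType.
Local Notation C := R[i].
Local Notation V := 'rV[C]_3.

(** Sections are functions, so forms are kept as functions as well; the zero function has every
    degree. *)
Definition form_fun (m : nat) (F : V -> C) : Prop :=
  exists2 p : {mpoly C[3]}, p \is m.-homog & F = evalv p.

Lemma form_const (c : C) : form_fun 0 (fun=> c).
Proof.
exists c%:MP; last by apply/funext => v; rewrite /evalv mevalC.
by rewrite -alg_mpolyC dhomogZ // dhomog1.
Qed.

Lemma form_coord (i : 'I_3) : form_fun 1 (fun v => v 0 i).
Proof.
exists 'X_i; last by apply/funext => v; rewrite /evalv mevalXU.
by rewrite dhomogX; apply/eqP; exact: mdeg1.
Qed.

Lemma form_add m F G : form_fun m F -> form_fun m G ->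
  form_fun m (fun v => F v + G v).
Proof.
move=> [p hp ->] [q hq ->]; exists (p + q); first exact: dhomogD.
by apply/funext => v; rewrite /evalv mevalD.
Qed.

Lemma form_mul m n F G : form_fun m F -> form_fun n G ->
  form_fun (m + n) (fun v => F v * G v).
Proof.
move=> [p hp ->] [q hq ->]; exists (p * q); first exact: dhomogM.
by apply/funext => v; rewrite /evalv mevalM.
Qed.

Lemma form_scale m c F : form_fun m F -> form_fun m (fun v => c * F v).
Proof. exact: (form_mul (form_const c)). Qed.

Lemma form_zero m : form_fun m (fun=> 0).
Proof.
exists 0; first exact: dhomog0.
by apply/funext => v; rewrite /evalv meval0.
Qed.

Lemma form_opp m F : form_fun m F -> form_fun m (fun v => - F v).
Proof.
by move=> /(form_scale (-1)); under eq_fun do rewrite mulN1r.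
Qed.

Lemma form_sub m F G : form_fun m F -> form_fun m G ->
  form_fun m (fun v => F v - G v).
Proof. by move=> hF /form_opp; apply: form_add. Qed.

Lemma form_sum m (I : Type) (r : seq I) (P : pred I) (F : I -> V -> C) :
  (forall i, P i -> form_fun m (F i)) ->
  form_fun m (fun v => \sum_(i <- r | P i) F i v).
Proof.
move=> hF; elim: r => [|i r IH].
  by under eq_fun do rewrite big_nil; apply: form_zero.
under eq_fun do rewrite big_cons.
by case: (boolP (P i)) => // Pi; apply: form_add => //; apply: hF.
Qed.

Lemma form_exp m k F : form_fun m F -> form_fun (m * k) (fun v => F v ^+ k).
Proof.
move=> hF; elim: k => [|k IH].
  by rewrite muln0; under eq_fun do rewrite expr0; apply: form_const.
by rewrite mulnS; under eq_fun do rewrite exprS; apply: form_mul.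
Qed.

(* Every form is a combination of products of coordinates, so that a property
   of forms can be proved by adding coordinate factors one at a time. *)
Lemma form_ind (K : nat -> (V -> C) -> Prop) :
  (forall m, K m (fun=> 0)) ->
  (forall c, K 0%N (fun=> c)) ->
  (forall m F G, K m F -> K m G -> K m (fun v => F v + G v)) ->
  (forall m i F, K m F -> K m.+1 (fun v => v 0 i * F v)) ->
  forall m F, form_fun m F -> K m F.
Proof.
move=> K0 Kc Kadd Kcoord m F [p /dhomogP hp ->].
have Kpow i a d G : K d G -> K (a + d)%N (fun v => v 0 i ^+ a * G v).
  move=> KG; elim: a => [|a IH].
    by under eq_fun do rewrite mul1r.
  by under eq_fun do rewrite exprS -mulrA; apply: Kcoord.
have -> : evalv p =
    (fun v => \sum_(k <- msupp p) p@_k * \prod_(i < 3) v 0 i ^+ k i).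
  by apply/funext => v; rewrite /evalv mevalE.
have: {subset msupp p <= msupp p} by [].
elim: {1 3}(msupp p) => [_|k s IH sub].
  by under eq_fun do rewrite big_nil; apply: K0.
under eq_fun do rewrite big_cons.
apply: Kadd; last by apply: IH => x xs; apply: sub; rewrite inE xs orbT.
have <- := hp k (sub k (mem_head _ _)).
under eq_fun => v do rewrite !big_ord_recl big_ord0 mulr1 mulrC -!mulrA.
rewrite /= mdegE !big_ord_recl big_ord0.
by do 3!apply: (Kpow); apply: Kc.
Qed.

Lemma form_homog m F : form_fun m F -> forall c v, F (c *: v) = c ^+ m * F v.
Proof.
move: m F; apply: form_ind => [m c v|c a v|m F G hF hG c v|m i F hF c v].
- by rewrite mulr0.
- by rewrite mul1r.
- by rewrite hF hG mulrDr.
- by rewrite mxE hF exprS; ring.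
Qed.

Lemma form_line m F : form_fun m F -> forall u w,
  exists g : {poly C}, forall t, F (u + t *: w) = g.[t].
Proof.
move: m F; apply: form_ind => [m u w|c u w|m F G hF hG u w|m i F hF u w].
- by exists 0 => t; rewrite horner0.
- by exists c%:P => t; rewrite hornerC.
- have [g eg] := hF u w; have [h eh] := hG u w.
  by exists (g + h) => t; rewrite hornerD eg eh.
- have [g eg] := hF u w; exists (((u 0 i)%:P + (w 0 i) *: 'X) * g) => t.
  by rewrite hornerM eg !mxE hornerD hornerC hornerZ hornerX [t * _]mulrC.
Qed.

Lemma poly_nonroot (g : {poly C}) : g != 0 -> exists t, g.[t] != 0.
Proof.
move=> g0; pose s := [seq (k%:R : C) | k <- iota 0 (size g)].
have [/allP sr|/allPn [t _]] := boolP (all (root g) s); last by exists t.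
have us : uniq s.
  by rewrite map_inj_uniq ?iota_uniq // => i j /eqP; rewrite eqr_nat => /eqP.
have := max_poly_roots g0 (introT allP sr) us.
by rewrite size_map size_iota ltnn.
Qed.

(** On the line joining [u] to [w] the product of the two restrictions is a nonzero polynomial in
    [t], since one factor is nonzero at 0 and the other at 1. This is the form in which
    irreducibility is used throughout. *)
Lemma form_line_dense m n F G u w : form_fun m F -> form_fun n G ->
  F u != 0 -> G w != 0 ->
  exists t, F (u + t *: (w - u)) != 0 /\ G (u + t *: (w - u)) != 0.
Proof.
move=> hF hG Fu Gw.
have [g eg] := form_line hF u (w - u); have [h eh] := form_line hG u (w - u).
have [t] : exists t, (g * h).[t] != 0.
  apply: poly_nonroot; rewrite mulf_neq0 //.
    by apply: contra_neq Fu => g0; rewrite -[u]addr0 -(scale0r (w - u)) eg g0 horner0.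
  apply: contra_neq Gw => h0.
  by rewrite -[w](subrK u) addrC -[w - u]scale1r eh h0 horner0.
by rewrite hornerM -eg -eh mulf_eq0 negb_or => /andP[]; exists t.
Qed.

Lemma form_dense m n F G u w : form_fun m F -> form_fun n G ->
  F u != 0 -> G w != 0 -> exists v, F v != 0 /\ G v != 0.
Proof.
by move=> hF hG Fu Gw; have [t ht] := form_line_dense hF hG Fu Gw; eexists; exact: ht.
Qed.

Definition dot (l v : V) : C := \sum_(j < 3) l 0 j * v 0 j.

Lemma dotE l v : dot l v = l 0 0 * v 0 0 + l 0 1 * v 0 1 + l 0 2%:R * v 0 2%:R.
Proof.
rewrite /dot !big_ord_recl big_ord0 addr0 addrA.
by congr (_ * v 0 _ + _ * v 0 _ + _ * v 0 _); try congr (l 0 _); apply/val_inj.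
Qed.

Lemma dotC l v : dot l v = dot v l.
Proof. by apply: eq_bigr => j _; rewrite mulrC. Qed.

Lemma dotDr l u v : dot l (u + v) = dot l u + dot l v.
Proof. by rewrite -big_split; apply: eq_bigr => j _; rewrite mxE mulrDr. Qed.

Lemma dotZr l c v : dot l (c *: v) = c * dot l v.
Proof. by rewrite mulr_sumr; apply: eq_bigr => j _; rewrite mxE mulrCA. Qed.

Lemma dotBr l u v : dot l (u - v) = dot l u - dot l v.
Proof. by rewrite -scaleN1r dotDr dotZr mulN1r. Qed.

Lemma dotZl l c v : dot (c *: l) v = c * dot l v.
Proof. by rewrite !(dotC _ v) dotZr. Qed.

Lemma form_dot l : form_fun 1 (dot l).
Proof. by apply: form_sum => j _; apply/form_scale/form_coord. Qed.

Lemma dot_neq0 l : l != 0 -> exists u, dot l u = 1.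
Proof.
move=> /rV0Pn[j lj]; exists ((l 0 j)^-1 *: delta_mx 0 j).
rewrite dotZr /dot (bigD1 j) //= big1 => [|k kj]; first last.
  by rewrite mxE eqxx (negPf kj) mulr0.
by rewrite mxE !eqxx mulr1 addr0 mulVf.
Qed.

(* [F v - F (v - l(v) u)] is divisible by [l] whenever [l(u) = 1]. *)
Lemma form_div_line m F l : l != 0 -> form_fun m.+1 F ->
  (forall v, dot l v = 0 -> F v = 0) ->
  exists2 G, form_fun m G & forall v, F v = dot l v * G v.
Proof.
move=> /dot_neq0[u lu] hF F0; pose pr v := v - dot l v *: u.
have fpr i : form_fun 1 (fun v => pr v 0 i).
  rewrite /pr; under eq_fun do rewrite !mxE mulrC.
  by apply: form_sub; [apply: form_coord|apply: form_scale; apply: form_dot].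
(* The quotient loses one degree, so in degree 0 it has to be recorded as the zero function. *)
pose K d F := form_fun d F /\ exists2 G,
  (if d is d'.+1 then form_fun d' G else G = fun=> 0) &
  forall v, F v - F (pr v) = dot l v * G v.
have [_ [G hG eG]] : K m.+1 F.
  move: hF {F0}; move: (m.+1) F; apply: form_ind => [d|c|d F G|d i F].
  - split; first exact: form_zero.
    exists (fun=> 0); first by case: d => // d; apply: form_zero.
    by move=> v; rewrite subrr mulr0.
  - split; first exact: form_const.
    by exists (fun=> 0) => // v; rewrite subrr mulr0.
  - move=> [hF [F' hF' eF]] [hG [G' hG' eG]]; split; first exact: form_add.
    exists (fun v => F' v + G' v).
      case: d hF' hG' {hF hG} => [|d hF' hG']; last exact: form_add.
      by move=> -> ->; apply/funext => v; rewrite addr0.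
    by move=> v; rewrite mulrDr -eF -eG; ring.
  - move=> [hF [F' hF' eF]]; split.
      by rewrite -add1n; apply: form_mul => //; apply: form_coord.
    exists (fun v => u 0 i * F v + pr v 0 i * F' v).
      apply: form_add; first exact: form_scale.
      case: d hF' {hF} => [->|d hF'].
        by under eq_fun do rewrite mulr0; apply: form_zero.
      by rewrite -add1n; apply: form_mul.
    move=> v; rewrite mulrDr [X in _ = _ + X]mulrCA -eF /pr !mxE; ring.
exists G => // v; rewrite -eG (F0 (pr v)) ?subr0 //.
by rewrite /pr dotBr dotZr lu mulr1 subrr.
Qed.

Definition nonproportional (l l' : V) := forall c : C, l != c *: l'.

Lemma nonproportional_witness l l' : l' != 0 -> nonproportional l l' ->
  exists2 w, dot l' w = 0 & dot l w != 0.
Proof.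
move=> l'0 hl; have [u l'u] := dot_neq0 l'0.
have /rV0Pn[j] : l - dot l u *: l' != 0 by rewrite subr_eq0.
(* A basis vector projected along [u] onto the line [l']; its value under [l] is the [j]-th
   coordinate of [l - dot l u *: l']. *)
rewrite !mxE => hj; exists (delta_mx 0 j - l' 0 j *: u).
all: have dd k : dot k (delta_mx 0 j) = k 0 j.
  1,3: by rewrite /dot (bigD1 j) //= big1 => [|i ij];
    rewrite mxE !eqxx ?(negPf ij) ?mulr1 ?addr0 ?mulr0.
all: rewrite dotBr dotZr dd ?l'u ?mulr1 ?subrr //.
by rewrite mulrC.
Qed.

(** Density inside a line of the plane: the segment from [v] to [w] stays in the zero set of [l]. *)
Lemma form_vanish_line m n F G l : form_fun m F -> form_fun n G ->
  (exists2 w, dot l w = 0 & F w != 0) ->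
  (forall v, dot l v = 0 -> F v != 0 -> G v = 0) ->
  forall v, dot l v = 0 -> G v = 0.
Proof.
move=> hF hG [w lw Fw] G0 v lv; apply/eqP/negP => /negP Gv.
have [t [/eqP Gt Ft]] := form_line_dense hG hF Gv Fw; apply: Gt; apply: G0 Ft.
by rewrite dotDr dotZr dotBr lv lw subrr mulr0 addr0.
Qed.

Definition line_prod (L : seq V) (v : V) : C := \prod_(l <- L) dot l v.

Lemma form_line_prod L : form_fun (size L) (line_prod L).
Proof.
elim: L => [|l L IH]; rewrite /line_prod.
  by under eq_fun do rewrite big_nil; apply: form_const.
under eq_fun do rewrite big_cons.
by rewrite /= -add1n; apply: form_mul => //; apply: form_dot.
Qed.

Definition line_family (L : seq V) :=
  [/\ forall l, l \in L -> l != 0, uniq L &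
      forall l l', l \in L -> l' \in L -> l != l' -> nonproportional l l'].

Lemma line_family_cons l L : line_family (l :: L) -> line_family L.
Proof.
move=> [L0 /= /andP[_ uL] Lp]; split=> // [k kL|k k' kL k'L].
  by apply: L0; rewrite inE kL orbT.
by apply: Lp; rewrite inE ?kL ?k'L orbT.
Qed.

(** After division by one form [l], the quotient still vanishes on every other line [l']: it does so
    where [l] is nonzero, which is dense in [l']. *)
Lemma form_div_lines m L F : line_family L -> form_fun (m + size L) F ->
  (forall l, l \in L -> forall v, dot l v = 0 -> F v = 0) ->
  exists2 G, form_fun m G & forall v, F v = line_prod L v * G v.
Proof.
elim: L F => [|l L IH] F hL hF F0.
  rewrite addn0 in hF; exists F => // v.
  by rewrite /line_prod big_nil mul1r.
have [L0 /= /andP[lL uL] Lp] := hL.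
rewrite addnS in hF.
have [G hG eG] := form_div_line (L0 l (mem_head _ _)) hF (F0 l (mem_head _ _)).
have [|l' l'L|H hH eH] := IH G _ hG; first exact: line_family_cons hL.
  apply: (form_vanish_line (form_dot l) hG).
    apply: nonproportional_witness; first by apply: L0; rewrite inE l'L orbT.
    apply: Lp; rewrite ?inE ?eqxx ?l'L ?orbT //.
    by apply: contraNneq lL => ->.
  move=> v lv lv0; apply/eqP; rewrite -(mulrI_eq0 _ (mulfI lv0)) -eG.
  by rewrite (F0 l') // inE l'L orbT.
exists H => // v; by rewrite eG eH mulrA /line_prod big_cons.
Qed.

End Forms.

(** * Determinants of three vectors *)

Section Determinants.
Variable R : realType.
Local Notation C := R[i].
Local Notation V := 'rV[C]_3.

Lemma ord3_ind (P : 'I_3 -> Prop) : P 0 -> P 1 -> P 2%:R -> forall i, P i.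
Proof.
move=> P0 P1 P2 [[|[|[|//]]] hi].
- by move: P0; congr P; apply/val_inj.
- by move: P1; congr P; apply/val_inj.
- by move: P2; congr P; apply/val_inj.
Qed.

Definition det3 (a b c : V) : C :=
  a 0 0 * (b 0 1 * c 0 2%:R - b 0 2%:R * c 0 1)
  - a 0 1 * (b 0 0 * c 0 2%:R - b 0 2%:R * c 0 0)
  + a 0 2%:R * (b 0 0 * c 0 1 - b 0 1 * c 0 0).

Lemma det3_cramer a b c p :
  det3 a b c *: p = det3 p b c *: a + det3 a p c *: b + det3 a b p *: c.
Proof. by apply/rowP; elim/ord3_ind; rewrite !mxE /det3; ring. Qed.

Lemma det3_perp l a b c : l != 0 ->
  dot l a = 0 -> dot l b = 0 -> dot l c = 0 -> det3 a b c = 0.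
Proof.
move=> /rV0Pn[j]; rewrite !dotE /det3 => lj la lb lc.
apply/eqP; rewrite -(mulrI_eq0 _ (mulfI lj)); apply/eqP; move: j lj.
(* With [x], [y], [z] the cofactors of column [j] of the matrix with rows [a], [b], [c], the
   combination below expands to [l 0 j] times the determinant. *)
have lin x y z : l 0 0 * a 0 0 + l 0 1 * a 0 1 + l 0 2%:R * a 0 2%:R = 0 ->
  l 0 0 * b 0 0 + l 0 1 * b 0 1 + l 0 2%:R * b 0 2%:R = 0 ->
  l 0 0 * c 0 0 + l 0 1 * c 0 1 + l 0 2%:R * c 0 2%:R = 0 ->
  (l 0 0 * a 0 0 + l 0 1 * a 0 1 + l 0 2%:R * a 0 2%:R) * x +
  (l 0 0 * b 0 0 + l 0 1 * b 0 1 + l 0 2%:R * b 0 2%:R) * y +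
  (l 0 0 * c 0 0 + l 0 1 * c 0 1 + l 0 2%:R * c 0 2%:R) * z = 0.
  by move=> -> -> ->; rewrite !mul0r !addr0.
elim/ord3_ind => _.
- rewrite -[RHS](lin (b 0 1 * c 0 2%:R - b 0 2%:R * c 0 1)
    (c 0 1 * a 0 2%:R - c 0 2%:R * a 0 1)
    (a 0 1 * b 0 2%:R - a 0 2%:R * b 0 1)) //; ring.
- rewrite -[RHS](lin (b 0 2%:R * c 0 0 - b 0 0 * c 0 2%:R)
    (c 0 2%:R * a 0 0 - c 0 0 * a 0 2%:R)
    (a 0 2%:R * b 0 0 - a 0 0 * b 0 2%:R)) //; ring.
- rewrite -[RHS](lin (b 0 0 * c 0 1 - b 0 1 * c 0 0)
    (c 0 0 * a 0 1 - c 0 1 * a 0 0)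
    (a 0 0 * b 0 1 - a 0 1 * b 0 0)) //; ring.
Qed.

Lemma form_det3 m n k (a b c : V -> V) :
  (forall j, form_fun m (fun v => a v 0 j)) ->
  (forall j, form_fun n (fun v => b v 0 j)) ->
  (forall j, form_fun k (fun v => c v 0 j)) ->
  form_fun (m + (n + k)) (fun v => det3 (a v) (b v) (c v)).
Proof.
move=> ha hb hc; rewrite /det3.
by apply: form_add; first apply: form_sub; apply: form_mul => //;
  apply: form_sub; apply: form_mul.
Qed.

End Determinants.

(** * Derivatives of a product of linear forms, and tangency *)

Section Gradient.
Variable R : realType.
Local Notation C := R[i].
Local Notation V := 'rV[C]_3.
Implicit Types (f g : {mpoly C[3]}) (s v l : V) (L : seq V).

Definition dir_deriv f s v : C := \sum_(j < 3) s 0 j * evalv f^`M(j) v.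

Definition grad f v : V := \row_j evalv f^`M(j) v.

Lemma dir_derivE f s v : dir_deriv f s v = dot (grad f v) s.
Proof. by apply: eq_bigr => j _; rewrite mxE mulrC. Qed.

Lemma dir_derivM f g s v :
  dir_deriv (f * g) s v = dir_deriv f s v * evalv g v + evalv f v * dir_deriv g s v.
Proof.
rewrite /dir_deriv mulr_suml mulr_sumr -big_split; apply: eq_bigr => j _ /=.
rewrite mderivM /evalv mevalD !mevalM mulrDr; congr (_ + _).
  by rewrite mulrA.
by rewrite mulrCA.
Qed.

Definition linear_poly l : {mpoly C[3]} := \sum_(j < 3) l 0 j *: 'X_j.

Lemma evalv_linear_poly l : evalv (linear_poly l) = dot l.
Proof.
apply/funext => v; rewrite /evalv /linear_poly raddf_sum; apply: eq_bigr => j _ /=.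
by rewrite mevalZ mevalXU.
Qed.

Lemma dir_deriv_linear_poly l s v : dir_deriv (linear_poly l) s v = dot l s.
Proof.
apply: eq_bigr => j _; rewrite mulrC; congr (_ * _).
rewrite /linear_poly raddf_sum /= (bigD1 j) //= big1 => [|k kj].
  rewrite mderivZ mderivX mnm1E eqxx mulr1n addr0.
  have -> : (U_(j) - U_(j))%MM = 0%MM by apply/mnmP => i; rewrite mnmBE subnn mnmE.
  by rewrite mpolyX0 /evalv mevalZ alg_mpolyC mevalC mulr1.
by rewrite mderivZ mderivX mnm1E (negPf kj) scale0r scaler0.
Qed.

Definition lines_poly L : {mpoly C[3]} := \prod_(l <- L) linear_poly l.

Lemma evalv_lines_poly L : evalv (lines_poly L) = line_prod L.
Proof.
apply/funext => v; rewrite /evalv /lines_poly rmorph_prod; apply: eq_bigr => l _.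
by rewrite -evalv_linear_poly.
Qed.

Lemma dot_delta l j : dot l (delta_mx 0 j) = l 0 j.
Proof.
rewrite /dot (bigD1 j) //= big1 => [|i ij]; rewrite mxE ?eqxx ?mulr1 ?addr0 //.
by rewrite (negPf ij) mulr0.
Qed.

Lemma dir_deriv_delta f v j : dir_deriv f (delta_mx 0 j) v = evalv f^`M(j) v.
Proof. by rewrite dir_derivE dot_delta mxE. Qed.

Lemma lines_poly_cons l L : lines_poly (l :: L) = linear_poly l * lines_poly L.
Proof. exact: big_cons. Qed.

Lemma line_prod_cons l L v : line_prod (l :: L) v = dot l v * line_prod L v.
Proof. exact: big_cons. Qed.

Lemma dir_deriv_cons l L s v : dir_deriv (lines_poly (l :: L)) s v =
  dot l s * line_prod L v + dot l v * dir_deriv (lines_poly L) s v.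
Proof.
by rewrite lines_poly_cons dir_derivM dir_deriv_linear_poly evalv_linear_poly
  evalv_lines_poly.
Qed.

Lemma dir_deriv_nil s v : dir_deriv (lines_poly [::]) s v = 0.
Proof.
rewrite /lines_poly big_nil /dir_deriv big1 // => j _.
by rewrite mderivC /evalv meval0 mulr0.
Qed.

Lemma form_grad L j : form_fun (size L).-1 (fun v => evalv (lines_poly L)^`M(j) v).
Proof.
under eq_fun do rewrite -dir_deriv_delta.
case: L => [|l L] /=.
  by under eq_fun do rewrite dir_deriv_nil; apply: form_zero.
elim: L l => [|l1 L IH] l; under eq_fun do rewrite dir_deriv_cons dot_delta.
  under eq_fun do rewrite dir_deriv_nil mulr0 addr0 /line_prod big_nil.
  exact: form_const.
apply: form_add; first by apply: form_scale; apply: form_line_prod.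
by rewrite -[size _]add1n; apply: form_mul; [apply: form_dot|apply: IH].
Qed.

(** Logarithmic differentiation: a vector that multiplies each linear form by its cofactor [p.2]
    multiplies their product by the sum of the cofactors. Lines and cofactors are paired because the
    cofactors depend on [v]. *)
Lemma dir_deriv_lines (lk : seq (V * C)) s v :
  (forall p, p \in lk -> dot p.1 s = dot p.1 v * p.2) ->
  dir_deriv (lines_poly (unzip1 lk)) s v =
    (\sum_(p <- lk) p.2) * line_prod (unzip1 lk) v.
Proof.
elim: lk => [|p lk IH] h; first by rewrite big_nil mul0r dir_deriv_nil.
rewrite /= dir_deriv_cons line_prod_cons big_cons.
rewrite IH => [|q qlk]; last by apply: h; rewrite inE qlk orbT.
by rewrite h ?mem_head // mulrDl -mulrA mulrCA [dot _ _ * (_ * _)]mulrCA mulrA.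
Qed.

Lemma dir_deriv_euler L v :
  dir_deriv (lines_poly L) v v = (size L)%:R * line_prod L v.
Proof.
elim: L => [|l L IH]; first by rewrite dir_deriv_nil mul0r.
by rewrite dir_deriv_cons IH line_prod_cons /= -natr1; ring.
Qed.

Lemma dir_deriv_on_line L l s v : uniq L -> l \in L -> dot l v = 0 ->
  dir_deriv (lines_poly L) s v = dot l s * line_prod (rem l L) v.
Proof.
move=> uL lL lv; rewrite /lines_poly (big_rem l) //= dir_derivM.
by rewrite dir_deriv_linear_poly evalv_linear_poly lv mul0r addr0 -evalv_lines_poly.
Qed.

Lemma line_prod_neq0 L v : (line_prod L v != 0) = all (fun l => dot l v != 0) L.
Proof. by rewrite /line_prod prodf_seq_neq0; apply: eq_all => l. Qed.

Lemma line_rem_generic L l : line_family L -> l \in L ->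
  exists2 w, dot l w = 0 & line_prod (rem l L) w != 0.
Proof.
move=> [L0 uL Lp] lL.
have : {subset rem l L <= [predD1 L & l]} by move=> k; rewrite mem_rem_uniq.
elim: (rem l L) => [_|k K IH sub].
  exists 0; first by rewrite -(scale0r 0) dotZr mul0r.
  by rewrite line_prod_neq0.
have [|w lw Kw] := IH; first by move=> x xK; apply: sub; rewrite inE xK orbT.
have := sub k (mem_head _ _); rewrite !inE => /andP[kl kL].
have [u lu ku] := nonproportional_witness (L0 l lL) (Lp _ _ kL lL kl).
have [t [h1 h2]] := form_line_dense (form_dot k) (form_line_prod K) ku Kw.
exists (u + t *: (w - u)).
  by rewrite dotDr dotZr dotBr lu lw subrr mulr0 addr0.
by rewrite /line_prod big_cons mulf_neq0.
Qed.

(** At a point of [l] the Leibniz rule leaves only the term in which [l] is differentiated, so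
    [dot l (P v)] vanishes off the other lines, hence on all of [l] by density. *)
Lemma syzygy_tangent L m (P : V -> V) l : line_family L -> l \in L ->
  (forall j, form_fun m (fun v => P v 0 j)) ->
  (forall v, dir_deriv (lines_poly L) (P v) v = 0) ->
  forall v, dot l v = 0 -> dot l (P v) = 0.
Proof.
move=> hL lL hP P0; have [_ uL _] := hL.
apply: (form_vanish_line (form_line_prod (rem l L)) (n := m)) => [||v lv lr].
- by apply: form_sum => j _; apply: form_scale.
- exact: line_rem_generic.
- have /eqP := P0 v; rewrite (dir_deriv_on_line _ uL lL lv) mulf_eq0 (negPf lr) orbF.
  by move/eqP.
Qed.

End Gradient.

(** * Sections of O(d) over Zariski open sets *)

Section TwistedSections.
Variable R : realType.
Local Notation C := R[i].
Local Notation V := 'rV[C]_3.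
Implicit Types (U W : set V) (s t : V -> C) (d : int).

Lemma twisted_sectionP d U s : twisted_section d U s <->
  (forall v, ~ U v -> s v = 0) /\
  forall v, U v -> exists P Q (m e : nat),
    [/\ form_fun m P, form_fun e Q, m%:Z = e%:Z + d, Q v != 0 &
        forall w, U w -> Q w != 0 -> s w = P w / Q w].
Proof.
split=> -[s0 hs]; split=> // v Uv.
  have [p [q [m [e [hp hq me qv spq]]]]] := hs v Uv.
  by exists (evalv p), (evalv q), m, e; split=> //; [exists p|exists q].
have [P [Q [m [e [[p hp eP] [q hq eQ] me Qv spq]]]]] := hs v Uv.
by exists p, q, m, e; split=> //; rewrite -?eP -?eQ.
Qed.

Lemma ts_out d U s v : twisted_section d U s -> ~ U v -> s v = 0.
Proof. by move=> [+ _]; apply. Qed.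

Lemma ts_add d U s t : twisted_section d U s -> twisted_section d U t ->
  twisted_section d U (fun v => s v + t v).
Proof.
move=> /twisted_sectionP[s0 hs] /twisted_sectionP[t0 ht]; apply/twisted_sectionP.
split=> [v Uv|v Uv]; first by rewrite s0 ?t0 ?addr0.
have [P [Q [m [e [hP hQ me Qv sPQ]]]]] := hs v Uv.
have [P' [Q' [m' [e' [hP' hQ' me' Qv' sPQ']]]]] := ht v Uv.
exists (fun w => P w * Q' w + P' w * Q w), (fun w => Q w * Q' w).
exists (m + e')%N, (e + e')%N; split.
- apply: form_add; first exact: form_mul.
  have -> : (m + e' = m' + e)%N.
    by apply/eqP; rewrite -eqz_nat !PoszD me me'; apply/eqP; ring.
  exact: form_mul.
- exact: form_mul.
- by rewrite !PoszD me addrAC.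
- by rewrite mulf_neq0.
- move=> w Uw; rewrite mulf_eq0 negb_or => /andP[Qw Q'w].
  by rewrite sPQ // sPQ' // addf_div.
Qed.

Lemma ts_mul d (e : int) U s t : twisted_section d U s -> twisted_section e U t ->
  twisted_section (d + e) U (fun v => s v * t v).
Proof.
move=> /twisted_sectionP[s0 hs] /twisted_sectionP[t0 ht]; apply/twisted_sectionP.
split=> [v Uv|v Uv]; first by rewrite s0 ?mul0r.
have [P [Q [m [k [hP hQ me Qv sPQ]]]]] := hs v Uv.
have [P' [Q' [m' [k' [hP' hQ' me' Qv' sPQ']]]]] := ht v Uv.
exists (fun w => P w * P' w), (fun w => Q w * Q' w), (m + m')%N, (k + k')%N; split.
- exact: form_mul.
- exact: form_mul.
- by rewrite !PoszD me me' addrACA.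
- by rewrite mulf_neq0.
- move=> w Uw; rewrite mulf_eq0 negb_or => /andP[Qw Q'w].
  by rewrite sPQ // sPQ' // mulf_div.
Qed.

Lemma ts_form m F U : form_fun m F -> twisted_section m U (patch (fun=> 0) U F).
Proof.
move=> hF; apply/twisted_sectionP; split=> [v Uv|v Uv].
  by rewrite patchN // notin_setE.
exists F, (fun=> 1), m, 0%N; split; rewrite ?oner_eq0 ?add0r //.
  exact: form_const.
by move=> w Uw _; rewrite patchT ?inE // divr1.
Qed.

Lemma ts_restrict d U W s : W `<=` U -> twisted_section d U s ->
  twisted_section d W (patch (fun=> 0) W s).
Proof.
move=> WU /twisted_sectionP[s0 hs]; apply/twisted_sectionP; split=> [v Wv|v Wv].
  by rewrite patchN // notin_setE.
have [P [Q [m [e [hP hQ me Qv sPQ]]]]] := hs v (WU _ Wv).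
exists P, Q, m, e; split=> // w Ww Qw; rewrite patchT ?inE //.
by apply: sPQ => //; apply: WU.
Qed.

Lemma ts_times_form (d : int) e U s (F : V -> C) : twisted_section d U s -> form_fun e F ->
  twisted_section (d + e%:Z) U (fun v => s v * F v).
Proof.
move=> hs hF; have := ts_mul hs (ts_form U hF).
set t := (X in twisted_section _ U X) => ht.
suff -> : (fun v => s v * F v) = t by [].
apply/funext => v; rewrite /t; have [Uv|nU] := pselect (U v).
  by rewrite patchT ?inE.
by rewrite (ts_out hs) // !mul0r.
Qed.

Lemma ts_scale d U c s : twisted_section d U s -> twisted_section d U (fun v => c * s v).
Proof.
move=> hs; have := ts_mul (ts_form U (form_const c)) hs; rewrite add0r.
set t := (X in twisted_section d U X) => ht.
suff -> : (fun v => c * s v) = t by [].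
apply/funext => v; rewrite /t /patch; case: ifPn => //.
by rewrite notin_setE => /(ts_out hs) ->; rewrite !mulr0.
Qed.

Lemma ts_opp d U s : twisted_section d U s -> twisted_section d U (fun v => - s v).
Proof. by move=> /(ts_scale (-1)); under eq_fun do rewrite mulN1r. Qed.

Lemma ts_sub d U s t : twisted_section d U s -> twisted_section d U t ->
  twisted_section d U (fun v => s v - t v).
Proof. by move=> hs /ts_opp; apply: ts_add. Qed.

Lemma ts_homog d U s c v : twisted_section d U s -> U v -> U (c *: v) ->
  c != 0 -> s (c *: v) = c ^ d * s v.
Proof.
move=> /twisted_sectionP[_ hs] Uv Ucv c0.
have [P [Q [m [e [hP hQ me Qv sPQ]]]]] := hs v Uv.
rewrite !sPQ //; last by rewrite (form_homog hQ) mulf_neq0 // expf_neq0.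
rewrite (form_homog hP) (form_homog hQ) -mulf_div; congr (_ * _).
by rewrite !exprnP me expfzDr // mulrAC divff ?mul1r // expfz_neq0.
Qed.

Lemma zariski_open_neq0 U v : zariski_open U -> U v -> v != 0.
Proof. by move=> [F _ ->] []. Qed.

Lemma zariski_open_nbhs U v : zariski_open U -> U v ->
  exists m G, [/\ form_fun m G, G v != 0 & forall w, w != 0 -> G w != 0 -> U w].
Proof.
move=> [F hF ->] [v0 [g Fg gv]]; have [m hg] := hF g Fg.
by exists m, (evalv g); split=> //; [exists g|split=> //; exists g].
Qed.

Lemma zariski_open_form m G : form_fun m G ->
  zariski_open [set v : V | v != 0 /\ G v != 0].
Proof.
move=> [g hg ->]; exists [set g]; first by move=> _ ->; exists m.
by apply/seteqP; split=> v /= [v0 h]; split=> //; [exists g|case: h => _ ->].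
Qed.

Lemma zariski_open_punctured : zariski_open [set v : V | v != 0].
Proof.
suff -> : [set v : V | v != 0] = [set v | v != 0 /\ (1 : C) != 0].
  exact: zariski_open_form (form_const 1).
by apply/seteqP; split=> v /=; [rewrite oner_eq0|case].
Qed.

(** Identity principle: where [s] is nonzero, its local numerator is a form nonzero at that point,
    so it is nonzero somewhere in [U] together with [F]. *)
Lemma ts_eq0_dense d U s m F u : zariski_open U -> twisted_section d U s ->
  form_fun m F -> F u != 0 -> (forall w, U w -> F w != 0 -> s w = 0) ->
  forall v, s v = 0.
Proof.
move=> oU hs hF Fu s0 v; apply/eqP/negP => /negP sv.
have [Uv|/(ts_out hs)/eqP] := pselect (U v); last by rewrite (negPf sv).
have /twisted_sectionP[_ /(_ v Uv)] := hs.
move=> [P [Q [k [e [hP hQ ke Qv sPQ]]]]].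
have [n [G [hG Gv GU]]] := zariski_open_nbhs oU Uv.
have /rV0Pn[i vi] := zariski_open_neq0 oU Uv.
have Pv : P v != 0 by apply: contra_neq sv => Pv; rewrite sPQ // Pv mul0r.
(* The coordinate factor keeps the point to be found away from the origin, which is excluded from
   every open cone. *)
have h := form_mul (form_mul hP hQ) (form_mul hG (form_coord R i)).
have [||w []] := form_dense h hF (u := v) (w := u) => //; first by rewrite !mulf_neq0.
rewrite !mulf_eq0 !negb_or => /andP[/andP[Pw Qw] /andP[Gw wi]] Fw.
have Uw : U w by apply: GU => //; apply/rV0Pn; exists i.
have /eqP := s0 w Uw Fw; rewrite sPQ // mulf_eq0 invr_eq0 (negPf Pw).
by rewrite (negPf Qw).
Qed.

End TwistedSections.

(** * Isomorphisms of sheaves of modules *)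

Section ModuleIso.
Variable R : realType.
Local Notation C := R[i].
Local Notation V := 'rV[C]_3.

Definition module_iso_map (k m : nat) (F : presheaf R k) (G : presheaf R m)
    (phi : set V -> (V -> 'rV[C]_k) -> (V -> 'rV[C]_m)) : Prop :=
  [/\ (forall U, zariski_open U -> set_bij (F U) (G U) (phi U)),
      (forall U, zariski_open U -> forall s t, F U s -> F U t ->
         phi U (fun v => s v + t v) = (fun v => phi U s v + phi U t v)),
      (forall U, zariski_open U -> forall a s,
         twisted_section 0 U a -> F U s ->
         phi U (fun v => a v *: s v) = (fun v => a v *: phi U s v)) &
      (forall U W, zariski_open U -> zariski_open W -> W `<=` U ->
         forall s, F U s ->
         phi W (restriction W s) = restriction W (phi U s))].

(** Linearity and compatibility with restriction are only required of maps on sections, so inverting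
    them needs these closure properties. *)
Definition module_presheaf (k : nat) (F : presheaf R k) : Prop :=
  [/\ forall U s t, F U s -> F U t -> F U (fun v => s v + t v),
      forall U a s, twisted_section 0 U a -> F U s -> F U (fun v => a v *: s v) &
      forall U W s, W `<=` U -> F U s -> F W (restriction W s)].

Lemma restriction_in (k : nat) (W : set V) (s : V -> 'rV[C]_k) v :
  W v -> restriction W s v = s v.
Proof. by move=> Wv; rewrite /restriction patchT ?inE. Qed.

Lemma restriction_out (k : nat) (W : set V) (s : V -> 'rV[C]_k) v :
  ~ W v -> restriction W s v = 0.
Proof. by move=> Wv; rewrite /restriction patchN // notin_setE. Qed.

Lemma restriction_coord (k : nat) (W : set V) (s : V -> 'rV[C]_k) j :
  (fun v => restriction W s v 0 j) = patch (fun=> 0) W (fun v => s v 0 j).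
Proof.
apply/funext => v; rewrite /restriction /patch.
by case: ifP => _ //; rewrite mxE.
Qed.

Lemma module_presheaf_sum_twists a b : module_presheaf (@sum_twists R a b).
Proof.
split=> [U s t [s0 s1] [t0 t1]|U c s hc [s0 s1]|U W s WU [s0 s1]].
- by split; under eq_fun do rewrite mxE; apply: ts_add.
- by split; under eq_fun do rewrite mxE;
    rewrite -[X in twisted_section X _ _]add0r; apply: ts_mul.
- by split; rewrite restriction_coord; apply: ts_restrict s0 || apply: ts_restrict s1.
Qed.

Lemma dir_derivD (f : {mpoly C[3]}) s t v :
  dir_deriv f (s + t) v = dir_deriv f s v + dir_deriv f t v.
Proof. by rewrite !dir_derivE dotDr. Qed.

Lemma dir_derivZ (f : {mpoly C[3]}) c s v :
  dir_deriv f (c *: s) v = c * dir_deriv f s v.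
Proof. by rewrite !dir_derivE dotZr. Qed.

Lemma module_presheaf_jacobian_kernel (f : {mpoly C[3]}) :
  module_presheaf (jacobian_kernel f).
Proof.
split=> [U s t [s0 s1] [t0 t1]|U c s hc [s0 s1]|U W s WU [s0 s1]].
- split=> [j|v Uv]; first by under eq_fun do rewrite mxE; apply: ts_add.
  by have := dir_derivD f (s v) (t v) v; rewrite /dir_deriv s1 // t1 // addr0.
- split=> [j|v Uv].
    by under eq_fun do rewrite mxE; rewrite -[X in twisted_section X _ _]add0r; apply: ts_mul.
  by have := dir_derivZ f (c v) (s v) v; rewrite /dir_deriv s1 // mulr0.
- split=> [j|v Wv]; first by rewrite restriction_coord; apply: ts_restrict (s0 j).
  by rewrite restriction_in // s1 //; apply: WU.
Qed.

(** Bijectivity holds open by open, so preimages are chosen for pairs (open set, section); each law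
    for the inverse follows by applying [phi] and its injectivity. *)
Lemma module_iso_map_inv k m (F : presheaf R k) (G : presheaf R m) phi :
  module_presheaf F -> module_presheaf G -> module_iso_map F G phi ->
  exists2 psi, module_iso_map G F psi &
    forall U, zariski_open U -> forall s, F U s -> psi U (phi U s) = s.
Proof.
move=> [Fadd Fmul Fres] [Gadd Gmul Gres] [bij add mul res].
have [psi hpsi] : exists psi : set V * (V -> 'rV[C]_m) -> (V -> 'rV[C]_k),
    forall x, zariski_open x.1 -> G x.1 x.2 -> F x.1 (psi x) /\ phi x.1 (psi x) = x.2.
  suff /boolp.choice[psi hpsi] : forall x : set V * (V -> 'rV[C]_m), exists s,
      zariski_open x.1 -> G x.1 x.2 -> F x.1 s /\ phi x.1 s = x.2 by exists psi.
  case=> U t /=.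
  have [[oU Gt]|nU] := pselect (zariski_open U /\ G U t).
    by have [_ _ /(_ t Gt)[s Fs st]] := bij U oU; exists s.
  by exists (fun=> 0) => oU Gt; case: nU.
have inj U s t : zariski_open U -> F U s -> F U t -> phi U s = phi U t -> s = t.
  by move=> oU Fs Ft; have [_ + _] := bij U oU; apply; rewrite inE.
have Gphi U s : zariski_open U -> F U s -> G U (phi U s).
  by move=> oU Fs; have [+ _ _] := bij U oU; apply.
have Fpsi U t : zariski_open U -> G U t -> F U (psi (U, t)).
  by move=> oU Gt; have [] := hpsi (U, t) oU Gt.
have phipsi U t : zariski_open U -> G U t -> phi U (psi (U, t)) = t.
  by move=> oU Gt; have [] := hpsi (U, t) oU Gt.
have psiphi U s : zariski_open U -> F U s -> psi (U, phi U s) = s.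
  by move=> oU Fs; apply: (inj U) => //; [apply: Fpsi; auto|rewrite phipsi; auto].
exists (fun U t => psi (U, t)); last by move=> U oU s; apply: psiphi.
split.
- move=> U oU; split=> [t Gt|s t|s Fs]; first exact: Fpsi.
    by rewrite !inE => Gs Gt e; rewrite -(phipsi U s) // e phipsi.
  by exists (phi U s); [apply: Gphi|apply: psiphi].
- move=> U oU s t Gs Gt; apply: (inj U) => //; first by apply: Fpsi => //; apply: Gadd.
    by apply: Fadd; apply: Fpsi.
  by rewrite phipsi ?add ?phipsi //; auto.
- move=> U oU a s ha Gs; apply: (inj U) => //; first by apply: Fpsi => //; apply: Gmul.
    by apply: Fmul => //; apply: Fpsi.
  by rewrite phipsi ?mul ?phipsi //; auto.
- move=> U W oU oW WU s Gs; apply: (inj W) => //.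
  + by apply: Fpsi => //; apply: Gres Gs.
  + by apply: Fres WU _; apply: Fpsi.
  + by rewrite (res U) ?phipsi //; [apply: Gres Gs|apply: Fpsi].
Qed.

End ModuleIso.

(** * Local fractions of syzygies *)

Section LocalSyzygies.
Variable R : realType.
Local Notation C := R[i].
Local Notation V := 'rV[C]_3.
Implicit Types (U : set V) (L : seq V) (s : V -> V).

(** A power [N] of a coordinate nonzero at [v] is put into the denominator so that its degree is at
    least [N]; this later protects differences such as [e - alpha] from truncation. *)
Lemma ts_common_denominator (d : int) U s v N : zariski_open U ->
  (forall j, twisted_section d U (fun v => s v 0 j)) -> U v ->
  exists (P : V -> V) Q m e,
    [/\ forall j, form_fun m (fun w => P w 0 j), form_fun e Q,
        m%:Z = e%:Z + d /\ (N <= e)%N, Q v != 0 &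
        forall w, U w -> Q w != 0 -> s w = (Q w)^-1 *: P w].
Proof.
move=> oU hs Uv.
have loc j := (proj2 ((twisted_sectionP _ _ _).1 (hs j)) v Uv).
have [P0 [Q0 [m0 [e0 [hP0 hQ0 me0 Qv0 sPQ0]]]]] := loc 0.
have [P1 [Q1 [m1 [e1 [hP1 hQ1 me1 Qv1 sPQ1]]]]] := loc 1.
have [P2 [Q2 [m2 [e2 [hP2 hQ2 me2 Qv2 sPQ2]]]]] := loc 2%:R.
have /rV0Pn[i vi] := zariski_open_neq0 oU Uv.
have hX := form_exp N (form_coord R i); rewrite mul1n in hX.
pose X w := (w : V) 0 i ^+ N.
pose P w : V := \row_j (if j == 0 then P0 w * (Q1 w * Q2 w) * X w
  else if j == 1 then P1 w * (Q0 w * Q2 w) * X w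
  else P2 w * (Q0 w * Q1 w) * X w).
exists P, (fun w => Q0 w * Q1 w * Q2 w * X w).
exists (m0 + (e1 + e2) + N)%N, (e0 + e1 + e2 + N)%N; split.
- elim/ord3_ind; rewrite /P; under eq_fun do rewrite mxE /=.
  + by do ?apply: form_mul.
  + have -> : (m0 + (e1 + e2) + N = m1 + (e0 + e2) + N)%N.
      by apply/eqP; rewrite -eqz_nat !PoszD me0 me1; apply/eqP; ring.
    by do ?apply: form_mul.
  + have -> : (m0 + (e1 + e2) + N = m2 + (e0 + e1) + N)%N.
      by apply/eqP; rewrite -eqz_nat !PoszD me0 me2; apply/eqP; ring.
    by do ?apply: form_mul.
- by do ?apply: form_mul.
- by split; [rewrite !PoszD me0; ring|rewrite leq_addl].
- by rewrite !mulf_neq0 // expf_neq0.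
- move=> w Uw; rewrite !mulf_eq0 !negb_or => /andP[/andP[/andP[q0 q1] q2] x].
  apply/rowP; elim/ord3_ind; rewrite !mxE /= ?sPQ0 ?sPQ1 ?sPQ2 //; field.
  all: by rewrite x q2 q1 q0.
Qed.

(** The numerator satisfies the syzygy relation on all of C^3 and not just over [U]: the relation is
    a form vanishing on a nonempty open set. *)
Lemma syzygy_common_denominator L (d : int) U s v N : zariski_open U ->
  (forall j, twisted_section d U (fun v => s v 0 j)) ->
  (forall w, U w -> dir_deriv (lines_poly L) (s w) w = 0) -> U v ->
  exists (P : V -> V) Q m e,
    [/\ forall j, form_fun m (fun w => P w 0 j), form_fun e Q,
        m%:Z = e%:Z + d /\ (N <= e)%N, Q v != 0 &
        (forall w, U w -> Q w != 0 -> s w = (Q w)^-1 *: P w) /\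
        (forall w, dir_deriv (lines_poly L) (P w) w = 0)].
Proof.
move=> oU hs ks Uv.
have [P [Q [m [e [hP hQ me Qv sPQ]]]]] := ts_common_denominator N oU hs Uv.
exists P, Q, m, e; split=> //; split=> // w; apply/eqP/negP => /negP Dw.
have hD : form_fun (m + (size L).-1) (fun w => dir_deriv (lines_poly L) (P w) w).
  by apply: form_sum => j _; apply: form_mul => //; apply: form_grad.
have [n [G [hG Gv GU]]] := zariski_open_nbhs oU Uv.
have /rV0Pn[i vi] := zariski_open_neq0 oU Uv.
have h := form_mul hQ (form_mul hG (form_coord R i)).
have [||x []] := form_dense h hD (u := v) (w := w) => //; first by rewrite !mulf_neq0.
rewrite !mulf_eq0 !negb_or => /andP[Qx /andP[Gx xi]].
have Ux : U x by apply: GU => //; apply/rV0Pn; exists i.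
have -> : P x = Q x *: s x by rewrite sPQ // scalerA divff // scale1r.
by rewrite dir_derivZ ks // mulr0 eqxx.
Qed.

Lemma section_tangent L (d : int) U s l v : line_family L -> zariski_open U ->
  (forall j, twisted_section d U (fun v => s v 0 j)) ->
  (forall w, U w -> dir_deriv (lines_poly L) (s w) w = 0) ->
  U v -> l \in L -> dot l v = 0 -> dot l (s v) = 0.
Proof.
move=> hL oU hs ks Uv lL lv.
have [P [Q [m [e [hP hQ me Qv [sPQ kP]]]]]] := syzygy_common_denominator 0 oU hs ks Uv.
by rewrite sPQ // dotZr (syzygy_tangent hL lL hP kP) // mulr0.
Qed.

Lemma line_prod_generic L : (forall l, l \in L -> l != 0) ->
  exists v, line_prod L v != 0.
Proof.
elim: L => [_|l L IH hL]; first by exists 0; rewrite line_prod_neq0.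
have [|w hw] := IH; first by move=> k kL; apply: hL; rewrite inE kL orbT.
have [u lu] := dot_neq0 (hL l (mem_head _ _)).
have lu0 : dot l u != 0 by rewrite lu oner_eq0.
have [v [h1 h2]] := form_dense (form_dot l) (form_line_prod L) lu0 hw.
by exists v; rewrite /line_prod big_cons mulf_neq0.
Qed.

Lemma det3_indep (u t1 t2 : V) x y x' y' : det3 u t1 t2 != 0 ->
  x *: t1 + y *: t2 = x' *: t1 + y' *: t2 -> x = x' /\ y = y'.
Proof.
move=> D0 e; split; apply/eqP; rewrite -subr_eq0 -(mulIr_eq0 _ (mulIf D0)); apply/eqP.
  have -> : (x - x') * det3 u t1 t2 =
      det3 u (x *: t1 + y *: t2) t2 - det3 u (x' *: t1 + y' *: t2) t2.
    by rewrite /det3 !mxE; ring.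
  by rewrite e subrr.
have -> : (y - y') * det3 u t1 t2 =
    det3 u t1 (x *: t1 + y *: t2) - det3 u t1 (x' *: t1 + y' *: t2).
  by rewrite /det3 !mxE; ring.
by rewrite e subrr.
Qed.

(** The three vectors lie in the plane orthogonal to the gradient, which is nonzero off the lines:
    by Euler its product with [v] is the nonzero number of lines times the value of the equation. *)
Lemma syzygies_det3 L p t1 t2 v :
  dir_deriv (lines_poly L) p v = 0 -> dir_deriv (lines_poly L) t1 v = 0 ->
  dir_deriv (lines_poly L) t2 v = 0 -> L != [::] -> line_prod L v != 0 ->
  det3 p t1 t2 = 0.
Proof.
move=> hp h1 h2 L0 Lv; apply: (@det3_perp _ (grad (lines_poly L) v)); rewrite -?dir_derivE //.
apply: contra_neq Lv => g0; have := dir_deriv_euler L v.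
rewrite dir_derivE g0 /dot big1 => [/esym/eqP|j _]; last by rewrite mxE mul0r.
by rewrite mulf_eq0 pnatr_eq0 size_eq0 (negPf L0) => /eqP.
Qed.

End LocalSyzygies.

(** * A criterion for freeness *)

Section FreeCriterion.
Variable R : realType.
Local Notation C := R[i].
Local Notation V := 'rV[C]_3.
Variables (L : seq V) (alpha beta : nat) (t1 t2 : V -> V) (c : C).
Hypothesis hL : line_family L.
Hypothesis form_t1 : forall j, form_fun alpha (fun v => t1 v 0 j).
Hypothesis form_t2 : forall j, form_fun beta (fun v => t2 v 0 j).
Hypothesis sum_degrees : (alpha + beta).+1 = size L.
Hypothesis syz_t1 : forall v, dir_deriv (lines_poly L) (t1 v) v = 0.
Hypothesis syz_t2 : forall v, dir_deriv (lines_poly L) (t2 v) v = 0.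
Hypothesis c_neq0 : c != 0.
Hypothesis det_t : forall v, det3 v (t1 v) (t2 v) = c * line_prod L v.

Let lines_nonempty : L != [::].
Proof. by apply: contra_eq_neq sum_degrees => ->. Qed.

Let le_alpha : (alpha <= size L)%N.
Proof. by rewrite -sum_degrees leqW // leq_addr. Qed.

Let le_beta : (beta <= size L)%N.
Proof. by rewrite -sum_degrees leqW // leq_addl. Qed.

Let det_neq0 v : line_prod L v != 0 -> det3 v (t1 v) (t2 v) != 0.
Proof. by move=> Lv; rewrite det_t mulf_neq0. Qed.

(** [A / Q] and [B / Q] are the local coefficients of [s] on the generators, of degrees -alpha and
    -beta. The bound on [e] makes the two natural subtractions exact. *)
Definition local_lift (U : set V) (s : V -> V) (A B Q : V -> C) : Prop :=
  exists e, [/\ (size L <= e)%N /\ form_fun (e - alpha) A,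
    form_fun (e - beta) B, form_fun e Q &
    forall w, U w -> Q w != 0 ->
      s w = (A w / Q w) *: t1 w + (B w / Q w) *: t2 w].

Lemma exists_local_lift U s v : zariski_open U ->
  jacobian_kernel (lines_poly L) U s -> U v ->
  exists A B Q, local_lift U s A B Q /\ Q v != 0.
Proof.
move=> oU [hs ks] Uv.
have [P [Q [m [e [hP hQ [me Ne] Qv [sPQ kP]]]]]] :=
  syzygy_common_denominator (size L) oU hs ks Uv.
have {}me : m = e by apply/eqP; rewrite -eqz_nat me addr0.
subst m.
have hv j : form_fun 1 (fun v : V => v 0 j) := form_coord R j.
(* Cramer numerators for the coefficients. On each line the three vectors in either determinant are
   tangent to it, so both determinants are divisible by the equation, of degree
   [alpha + beta + 1]. *)
have hA : form_fun ((e - alpha) + size L) (fun w => det3 w (P w) (t2 w)).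
  have -> : ((e - alpha) + size L = 1 + (e + beta))%N.
    by rewrite -sum_degrees addnS addnA subnK ?(leq_trans le_alpha) // add1n.
  exact: form_det3.
have hB : form_fun ((e - beta) + size L) (fun w => det3 w (t1 w) (P w)).
  have -> : ((e - beta) + size L = 1 + (alpha + e))%N.
    by rewrite -sum_degrees addnS [(alpha + beta)%N]addnC addnA subnK
      ?(leq_trans le_beta) // add1n addnC.
  exact: form_det3.
have [L0 uL _] := hL.
have [|A fA eA] := form_div_lines hL hA.
  move=> l lL w lw; apply: (det3_perp (L0 l lL)) => //.
    exact: (syzygy_tangent hL lL hP kP).
  exact: (syzygy_tangent hL lL form_t2 syz_t2).
have [|B fB eB] := form_div_lines hL hB.
  move=> l lL w lw; apply: (det3_perp (L0 l lL)) => //.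
    exact: (syzygy_tangent hL lL form_t1 syz_t1).
  exact: (syzygy_tangent hL lL hP kP).
(* Off the lines this is Cramer's rule divided by the equation, the term along [w] dropping out
   because [P], [t1], [t2] are dependent. Density extends it to points of the lines. *)
have key w : c *: P w = A w *: t1 w + B w *: t2 w.
  apply/rowP => j; apply/eqP; rewrite -subr_eq0; apply/negP => /negP nz.
  have hD : form_fun e (fun w => (c *: P w) 0 j - (A w *: t1 w + B w *: t2 w) 0 j).
    under eq_fun do rewrite !mxE.
    apply: form_sub; first exact: form_scale.
    apply: form_add.
      by rewrite -(subnK (_ : alpha <= e)%N) ?form_mul //; [exact: form_mul|exact: leq_trans Ne].
    by rewrite -(subnK (_ : beta <= e)%N) ?form_mul //; [exact: form_mul|exact: leq_trans Ne].
  have [u Lu] := line_prod_generic L0.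
  have [x [Lx]] := form_dense (form_line_prod L) hD Lu nz.
  have := det3_cramer x (t1 x) (t2 x) (P x).
  rewrite (syzygies_det3 (kP x) (syz_t1 x) (syz_t2 x)) // scale0r add0r.
  rewrite det_t eA eB mulrC -!scalerA -scalerDr => /(scalerI Lx) ->.
  by rewrite subrr eqxx.
exists (fun w => c^-1 * A w), (fun w => c^-1 * B w), Q; split=> //.
exists e; split; [by split=> //; apply: form_scale|exact: form_scale|by []|].
move=> w Uw Qw; rewrite sPQ //.
have -> : P w = c^-1 *: (A w *: t1 w + B w *: t2 w).
  by rewrite -key scalerA mulVf // scale1r.
by rewrite !scalerDr !scalerA; congr (_ *: _ + _ *: _); ring.
Qed.

(** [t1] and [t2] become dependent on the lines, so the coefficients cannot be compared there
    directly: the cross-multiplied differences are forms that vanish off the lines, hence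
    everywhere. *)
Lemma local_lift_unique U s A B Q A' B' Q' w : zariski_open U ->
  local_lift U s A B Q -> local_lift U s A' B' Q' -> U w ->
  Q w != 0 -> Q' w != 0 -> A w / Q w = A' w / Q' w /\ B w / Q w = B' w / Q' w.
Proof.
move=> oU [e [[Ne hA] hB hQ es]] [e' [[Ne' hA'] hB' hQ' es']] Uw Qw Qw'.
have [L0 _ _] := hL.
have [u Lu] := line_prod_generic L0.
have [n [G [hG Gw GU]]] := zariski_open_nbhs oU Uw.
have /rV0Pn[i wi] := zariski_open_neq0 oU Uw.
have h := form_mul (form_line_prod L) (form_mul (form_mul hQ hQ') (form_mul hG (form_coord R i))).
have gen x : line_prod L x * ((Q x * Q' x) * (G x * x 0 i)) != 0 ->
    A x * Q' x - A' x * Q x = 0 /\ B x * Q' x - B' x * Q x = 0.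
  rewrite !mulf_eq0 !negb_or => /andP[Lx /andP[/andP[Qx Qx'] /andP[Gx xi]]].
  have Ux : U x by apply: GU => //; apply/rV0Pn; exists i.
  have := es x Ux Qx; rewrite es' // => /(det3_indep (det_neq0 Lx))[e1 e2].
  have cross (a b a' b' : C) : b != 0 -> b' != 0 -> a' / b' = a / b -> a * b' - a' * b = 0.
    move=> b0 b0' /eqP; rewrite eqr_div // => /eqP ->; rewrite mulrC subrr //.
  by split; apply: cross.
have nz0 : (Q w * Q' w) * (G w * w 0 i) != 0 by rewrite !mulf_neq0.
have [x0 hx0] : exists x, line_prod L x * ((Q x * Q' x) * (G x * x 0 i)) != 0.
  have [x [h1 h2]] := form_dense (form_line_prod L)
    (form_mul (form_mul hQ hQ') (form_mul hG (form_coord R i))) Lu nz0.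
  by exists x; rewrite mulf_neq0.
have zero d F : form_fun d F -> (forall x,
    line_prod L x * ((Q x * Q' x) * (G x * x 0 i)) != 0 -> F x = 0) -> F w = 0.
  move=> hF F0; apply/eqP/negP => /negP Fw.
  have [x [h1 /eqP[]]] := form_dense h hF hx0 Fw; exact: F0.
have cross (a b a' b' : C) : b != 0 -> b' != 0 -> a * b' - a' * b = 0 -> a / b = a' / b'.
  by move=> b0 b0' /eqP; rewrite subr_eq0 => e0; apply/eqP; rewrite eqr_div.
split; apply: cross => //.
  apply: (zero (e - alpha + e')%N (fun x => A x * Q' x - A' x * Q x)) => [|x /gen[]//].
  apply: form_sub; first exact: form_mul.
  have -> : (e - alpha + e' = e' - alpha + e)%N.
    by rewrite !addnBAC ?(leq_trans le_alpha) // addnC.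
  exact: form_mul.
apply: (zero (e - beta + e')%N (fun x => B x * Q' x - B' x * Q x)) => [|x /gen[]//].
apply: form_sub; first exact: form_mul.
have -> : (e - beta + e' = e' - beta + e)%N.
  by rewrite !addnBAC ?(leq_trans le_beta) // addnC.
exact: form_mul.
Qed.

(** Each point chooses its own local lift and the coefficient is evaluated there; by uniqueness the
    lift chosen at [v] computes it wherever its denominator is nonzero in [U], so the result is a
    section. *)
Lemma jacobian_kernel_lift U s : zariski_open U ->
  jacobian_kernel (lines_poly L) U s ->
  exists a b : V -> C,
    [/\ twisted_section (- alpha%:Z) U a, twisted_section (- beta%:Z) U b &
        forall v, s v = a v *: t1 v + b v *: t2 v].
Proof.
move=> oU ks.
have /boolp.choice[r hr] : forall v, exists r : (V -> C) * (V -> C) * (V -> C),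
    U v -> local_lift U s r.1.1 r.1.2 r.2 /\ r.2 v != 0.
  move=> v; have [Uv|nU] := pselect (U v); last by exists (fun=> 0, fun=> 0, fun=> 0).
  by have [A [B [Q h]]] := exists_local_lift oU ks Uv; exists (A, B, Q).
exists (patch (fun=> 0) U (fun v => (r v).1.1 v / (r v).2 v)).
exists (patch (fun=> 0) U (fun v => (r v).1.2 v / (r v).2 v)).
split; first 1 last.
- apply/twisted_sectionP; split=> [v Uv|v Uv]; first by rewrite patchN // notin_setE.
  have [lv Qv] := hr v Uv; have [e [[Ne hA] hB hQ es]] := lv.
  exists (r v).1.2, (r v).2, (e - beta)%N, e; split=> //; first by rewrite -subzn // (leq_trans _ Ne).
  move=> w Uw Qw; have [lw Qw'] := hr w Uw; rewrite patchT ?inE //.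
  by have [_ ->] := local_lift_unique oU lw lv Uw Qw' Qw.
- move=> v; have [Uv|nU] := pselect (U v); last first.
    rewrite !patchN ?notin_setE // !scale0r addr0.
    by apply/rowP => j; rewrite (ts_out (proj1 ks j)) // mxE.
  have [[e [_ _ _ es]] Qv] := hr v Uv.
  by rewrite !patchT ?inE // -es.
- apply/twisted_sectionP; split=> [v Uv|v Uv]; first by rewrite patchN // notin_setE.
  have [lv Qv] := hr v Uv; have [e [[Ne hA] hB hQ es]] := lv.
  exists (r v).1.1, (r v).2, (e - alpha)%N, e; split=> //; first by rewrite -subzn // (leq_trans _ Ne).
  move=> w Uw Qw; have [lw Qw'] := hr w Uw; rewrite patchT ?inE //.
  by have [-> _] := local_lift_unique oU lw lv Uw Qw' Qw.
Qed.

(** Saito's criterion, in sheaf form. *)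
Lemma free_criterion : module_iso (jacobian_kernel (lines_poly L))
  (sum_twists (- alpha%:Z) (- beta%:Z)).
Proof.
(* The explicit map goes from the sum of twists to the kernel, opposite to the required direction,
   and is inverted at the end. *)
pose psi (U : set V) (s : V -> 'rV[C]_2) v := s v 0 0 *: t1 v + s v 0 1 *: t2 v.
suff isopsi : module_iso_map (sum_twists (- alpha%:Z) (- beta%:Z))
    (jacobian_kernel (lines_poly L)) psi.
  have [phi isophi _] := module_iso_map_inv (@module_presheaf_sum_twists R _ _)
    (module_presheaf_jacobian_kernel _) isopsi.
  by exists phi.
have eq0 a U t : zariski_open U -> twisted_section a U t ->
    (forall w, U w -> line_prod L w != 0 -> t w = 0) -> forall v, t v = 0.
  move=> oU ht h; have [L0 _ _] := hL; have [u Lu] := line_prod_generic L0.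
  exact: ts_eq0_dense oU ht (form_line_prod L) Lu h.
split.
- move=> U oU; split=> [s [s0 s1]|s t|s ks].
  + split=> [j|v Uv].
      under eq_fun do rewrite !mxE; apply: ts_add.
        by rewrite -(addNr alpha%:Z); apply: ts_times_form.
      by rewrite -(addNr beta%:Z); apply: ts_times_form.
    have := dir_derivD (lines_poly L) (s v 0 0 *: t1 v) (s v 0 1 *: t2 v) v.
    by rewrite !dir_derivZ syz_t1 syz_t2 !mulr0 addr0.
  + rewrite !inE => -[s0 s1] [t0 t1'] e.
    have st w : line_prod L w != 0 -> s w 0 0 = t w 0 0 /\ s w 0 1 = t w 0 1.
      by move=> Lw; apply: (det3_indep (det_neq0 Lw)); exact: (congr1 (@^~ w) e).
    apply/funext => v; apply/rowP => -[[|[|//]] hj].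
      have := eq0 _ _ _ oU (ts_sub s0 t0).
      move=> /(_ _ v)/eqP; rewrite subr_eq0 => h; have -> : Ordinal hj = 0 by apply/val_inj.
      by apply/eqP/h => w _ /st[-> _]; rewrite subrr.
    have := eq0 _ _ _ oU (ts_sub s1 t1').
    move=> /(_ _ v)/eqP; rewrite subr_eq0 => h; have -> : Ordinal hj = 1 by apply/val_inj.
    by apply/eqP/h => w _ /st[_ ->]; rewrite subrr.
  + have [a [b [ha hb sab]]] := jacobian_kernel_lift oU ks.
    exists (fun v => \row_j (if j == 0 then a v else b v)).
      by split; under eq_fun do rewrite mxE.
    by apply/funext => v; rewrite sab /psi !mxE.
- move=> U oU s t _ _; apply/funext => v.
  by rewrite /psi !mxE !scalerDl addrACA.
- move=> U oU a s _ _; apply/funext => v.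
  by rewrite /psi !mxE scalerDr !scalerA.
- move=> U W oU oW WU s _; apply/funext => v.
  have [Wv|nW] := pselect (W v); first by rewrite /psi !restriction_in.
  by rewrite /psi !restriction_out // !mxE !scale0r addr0.
Qed.

End FreeCriterion.

(** * A criterion for non-freeness *)

Section RestrictionToLines.
Variable R : realType.
Local Notation C := R[i].
Local Notation V := 'rV[C]_3.
Local Notation punctured := [set v : V | v != 0].

Lemma poly_eq0_cofinite (g q : {poly C}) : q != 0 ->
  (forall t, q.[t] != 0 -> g.[t] = 0) -> g = 0.
Proof.
move=> q0 h; apply/eqP/negP => /negP g0.
have [t] := poly_nonroot (mulf_neq0 g0 q0).
by rewrite hornerM mulf_eq0 negb_or => /andP[/eqP + /h].
Qed.

Lemma poly_eq0_punctured (g : {poly C}) : (forall t, t != 0 -> g.[t] = 0) -> g = 0.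
Proof.
move=> h; apply: (poly_eq0_cofinite (negbT (polyX_eq0 C))) => t.
by rewrite hornerX; apply: h.
Qed.

(** Regular functions on the affine line are polynomials: with the fraction at 0 in lowest terms,
    its denominator divides every local denominator. *)
Lemma locally_rational_poly (phi : C -> C) :
  (forall t0, exists p q : {poly C}, q.[t0] != 0 /\
     forall t, q.[t] != 0 -> phi t = p.[t] / q.[t]) ->
  exists g : {poly C}, forall t, phi t = g.[t].
Proof.
move=> loc; have [p [q [q00 pq]]] := loc 0.
have q0 : q != 0 by apply: contra_neq q00 => ->; rewrite horner0.
pose d := gcdp p q; pose p' := p %/ d; pose q' := q %/ d.
have d0 : d != 0 by rewrite gcdp_eq0 negb_and q0 orbT.
have ep : p = p' * d by rewrite divpK // dvdp_gcdl.
have eq_ : q = q' * d by rewrite divpK // dvdp_gcdr.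
have cop : coprimep q' p'.
  by rewrite coprimep_sym; apply: coprimep_div_gcd; rewrite q0 orbT.
have cross t0 : exists p1 q1 : {poly C}, [/\ q1.[t0] != 0,
    phi t0 = p1.[t0] / q1.[t0] & p' * q1 = p1 * q'].
  have [p1 [q1 [q1t e1]]] := loc t0; exists p1, q1; split; rewrite ?e1 //.
  have q10 : q1 != 0 by apply: contra_neq q1t => ->; rewrite horner0.
  apply/eqP; rewrite -subr_eq0; apply/eqP.
  apply: (poly_eq0_cofinite (mulf_neq0 q0 q10)) => t.
  rewrite hornerM mulf_eq0 negb_or => /andP[qt q1t'].
  have := pq t qt; rewrite e1 // => /eqP; rewrite eqr_div // ep eq_ !hornerM.
  have dt : d.[t] != 0 by apply: contraNneq qt; rewrite eq_ hornerM => ->; rewrite mulr0.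
  move=> /eqP e; apply: (mulIf dt).
  rewrite mul0r hornerD hornerN !hornerM mulrBl.
  by rewrite [_ * _ * d.[t]]mulrAC -e mulrA subrr.
(* A root [t0] of [q'] would be a root of the denominator valid at [t0], as [q'] divides it by
   Gauss; C being algebraically closed, [q'] is constant. *)
have sq' : size q' == 1%N.
  apply: contraTT isT => /closed_rootP[t0 rt0].
  have [p1 [q1 [q1t _ e]]] := cross t0; case/negP: q1t.
  have : q' %| q1 by rewrite -(Gauss_dvdpr _ cop) e dvdp_mull.
  by move=> /dvdpP[k ->]; rewrite hornerM (eqP rt0) mulr0.
have /size_poly1P[c c0 ec] := sq'.
exists (c^-1 *: p') => t; have [p1 [q1 [q1t -> e]]] := cross t.
have := congr1 (horner^~ t) e; rewrite /= !hornerM ec hornerC hornerZ => e'.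
by apply: (mulIf q1t); rewrite mulfVK // -mulrA e' mulrC mulfK.
Qed.

Definition independent (u w : V) :=
  forall x y : C, x *: u + y *: w = 0 -> x = 0 /\ y = 0.

Lemma independent_sym u w : independent u w -> independent w u.
Proof. by move=> h x y; rewrite addrC => /h[]. Qed.

Lemma independent_neq0 u w t : independent u w -> u + t *: w != 0.
Proof.
move=> h; apply/eqP; rewrite -[u]scale1r => /h[/eqP].
by rewrite oner_eq0.
Qed.

Lemma ts_line_poly (d : int) s u w : twisted_section d punctured s ->
  independent u w -> exists g : {poly C}, forall t, s (u + t *: w) = g.[t].
Proof.
move=> /twisted_sectionP[_ hs] uw; apply: locally_rational_poly => t0.
have [P [Q [m [e [hP hQ _ Qv sPQ]]]]] := hs _ (independent_neq0 t0 uw).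
have [p ep] := form_line hP u w; have [q eq_] := form_line hQ u w.
exists p, q; rewrite -eq_; split=> // t; rewrite -eq_ => qt.
by rewrite sPQ ?ep //; apply: independent_neq0.
Qed.

Lemma ts_line_inv (d : int) s u w t : twisted_section d punctured s ->
  independent u w -> t != 0 -> s (u + t *: w) = t ^ d * s (w + t^-1 *: u).
Proof.
move=> hs uw t0; have -> : u + t *: w = t *: (w + t^-1 *: u).
  by rewrite scalerDr scalerA divff // scale1r addrC.
have n0 := independent_neq0 t^-1 (independent_sym uw).
by apply: (ts_homog hs) => //=; rewrite scaler_eq0 negb_or t0.
Qed.

Lemma horner_rev_poly (h : {poly C}) t : t != 0 -> h != 0 ->
  t ^+ (size h).-1 * h.[t^-1] =
  (\poly_(i < size h) h`_((size h).-1 - i)).[t].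
Proof.
move=> t0 h0; rewrite horner_poly horner_coef mulr_sumr (reindex_inj rev_ord_inj) /=.
have sh : (0 < size h)%N by rewrite size_poly_gt0.
apply: eq_bigr => i _; have hi : (i <= (size h).-1)%N by rewrite -ltnS prednK.
have -> : (size h - i.+1 = (size h).-1 - i)%N by rewrite -{1}(prednK sh) subSS.
rewrite mulrCA exprVn; congr (_ * _).
by rewrite -[in LHS](subnKC hi) exprD addKn mulfK // expf_neq0.
Qed.

(** Degree bound for O(d) on the projective line: [g] and its counterpart [h] at the other end
    satisfy g(t) = t^d h(1/t). Reversing the coefficients of [h] turns this into an identity of
    polynomials, arranged according to the sign of [d]; for negative [d] only [g = 0] survives. *)
Lemma ts_line_size (d : int) s u w (g : {poly C}) :
  twisted_section d punctured s -> independent u w ->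
  (forall t, s (u + t *: w) = g.[t]) -> g = 0 \/ (size g)%:Z <= d + 1.
Proof.
move=> hs uw eg; have [h eh] := ts_line_poly hs (independent_sym uw).
have gh t : t != 0 -> g.[t] = t ^ d * h.[t^-1].
  by move=> t0; rewrite -eg -eh; apply: ts_line_inv.
have [g0|g0] := eqVneq g 0; [by left|right].
have h0 : h != 0.
  apply: contra_neq g0 => h0; apply: poly_eq0_punctured => t t0.
  by rewrite gh // h0 horner0 mulr0.
have sh : (0 < size h)%N by rewrite size_poly_gt0.
pose r := \poly_(i < size h) h`_((size h).-1 - i).
have sr : (size r <= size h)%N by apply: size_poly.
case: d hs gh => n hs gh.
  have e : g * 'X^((size h).-1) = r * 'X^n.
    apply/eqP; rewrite -subr_eq0; apply/eqP.
    apply: poly_eq0_punctured => t t0.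
    rewrite !hornerE gh // -horner_rev_poly //.
    by rewrite -exprnP; ring.
  have r0 : r != 0.
    apply/eqP => r0; move/eqP: e; rewrite -/r r0 mul0r mulf_eq0 (negPf g0) /=.
    by rewrite (negPf (monic_neq0 (monicXn _ _))).
  have := congr1 (fun p : {poly C} => size p) e; rewrite !size_mulXn // => e'.
  have : (size g <= n + 1)%N by move: e' sr sh; lia.
  by lia.
have e : g * 'X^((size h).-1 + n.+1) = r.
  apply/eqP; rewrite -subr_eq0; apply/eqP.
  apply: poly_eq0_punctured => t t0.
  rewrite !hornerE gh // -horner_rev_poly //.
  rewrite NegzE -exprnN exprD; have := expf_neq0 n.+1 t0.
  by move=> tn; field.
have := congr1 (fun p : {poly C} => size p) e; rewrite size_mulXn // => e'.
have : (0 < size g)%N by rewrite size_poly_gt0.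
by move: e' sr sh; lia.
Qed.

(** More zeros than the degree. The empty list is allowed and covers negative [d]. *)
Lemma ts_line_vanish (d : int) s u w (ts : seq C) :
  twisted_section d punctured s -> independent u w -> uniq ts ->
  d < (size ts)%:Z -> (forall t, t \in ts -> s (u + t *: w) = 0) ->
  forall t, s (u + t *: w) = 0.
Proof.
move=> hs uw us dts s0 t; have [g eg] := ts_line_poly hs uw.
have [g0|sg] := ts_line_size hs uw eg; first by rewrite eg g0 horner0.
rewrite eg; suff -> : g = 0 by rewrite horner0.
apply/eqP/negP => /negP g0.
have rts : all (root g) ts by apply/allP => x xs; rewrite /root -eg s0.
have := max_poly_roots g0 rts us; rewrite -ltz_nat ltNge.
by rewrite (le_trans sg) // lezD1.
Qed.

Lemma ts_line_zero (d : int) s u w : twisted_section d punctured s ->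
  independent u w -> 0 < d ->
  exists x y, [/\ x *: u + y *: w != 0 & s (x *: u + y *: w) = 0].
Proof.
case: d => // d hs uw d0; have [g eg] := ts_line_poly hs uw.
have [sg|sg] := eqVneq (size g) 1%N; last first.
  have /closed_rootP[t /eqP gt] := sg.
  by exists 1, t; rewrite scale1r independent_neq0 // eg.
(* A nonzero constant [g] has all its zeros at infinity, that is at [w]: there the section reads c
   t^d, which vanishes at 0 as [d] is positive. *)
have [h eh] := ts_line_poly hs (independent_sym uw).
exists 0, 1; rewrite scale0r scale1r add0r.
have w0 : w != 0 by have := independent_neq0 0 (independent_sym uw); rewrite scale0r addr0.
split=> //; have [c _ ec] := size_poly1P _ (introT eqP sg).
have : h - c *: 'X^d = 0.
  apply: poly_eq0_punctured => t t0.
  rewrite !hornerE -eh (ts_line_inv hs (independent_sym uw) t0) eg ec hornerC.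
  by rewrite -exprnP mulrC subrr.
move=> /eqP; rewrite subr_eq0 => /eqP e.
have := eh 0; rewrite scale0r addr0 => ->; rewrite e !hornerE.
by rewrite expr0n; case: d d0 {hs e} => // d _; rewrite mulr0.
Qed.

End RestrictionToLines.

(** * Twisting by charts, and transport of generators *)

Section Charts.
Variable R : realType.
Local Notation C := R[i].
Local Notation V := 'rV[C]_3.
Local Notation punctured := [set v : V | v != 0].

Definition chart (i : 'I_3) : set V := [set v : V | v != 0 /\ v 0 i != 0].

Lemma zariski_open_chart i : zariski_open (chart i).
Proof. exact: zariski_open_form (form_coord R i). Qed.

Lemma chart_coord i (v : V) : chart i v -> v 0 i != 0. Proof. by case. Qed.

Lemma coord_chart i (v : V) : v 0 i != 0 -> chart i v.
Proof. by move=> vi; split=> //; apply/rV0Pn; exists i. Qed.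

Definition coord_pow (U : set V) (i : 'I_3) (k : int) : V -> C :=
  patch (fun=> 0) U (fun v => v 0 i ^ k).

Lemma coord_powE U i k v : U v -> coord_pow U i k v = v 0 i ^ k.
Proof. by move=> Uv; rewrite /coord_pow patchT ?inE. Qed.

Lemma coord_pow_out U i k v : ~ U v -> coord_pow U i k v = 0.
Proof. by move=> Uv; rewrite /coord_pow patchN // notin_setE. Qed.

Lemma ts_coord_pow (U : set V) i k : (forall v : V, U v -> v 0 i != 0) ->
  twisted_section k U (coord_pow U i k).
Proof.
move=> Ui; case: k => n.
  apply: (@ts_form _ n (fun v => v 0 i ^+ n) U).
  by have := form_exp n (form_coord R i); rewrite mul1n.
apply/twisted_sectionP; split=> [v Uv|v Uv]; first exact: coord_pow_out.
exists (fun=> 1), (fun v => v 0 i ^+ n.+1), 0%N, n.+1; split.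
- exact: form_const.
- by have := form_exp n.+1 (form_coord R i); rewrite mul1n.
- by rewrite NegzE subrr.
- by rewrite expf_neq0 // Ui.
- by move=> w Uw _; rewrite coord_powE // NegzE -exprnN mul1r.
Qed.

Lemma coord_powK i k (v : V) : chart i v ->
  v 0 i ^ k * coord_pow (chart i) i (- k) v = 1.
Proof.
move=> cv; rewrite (coord_powE _ _ cv) -invr_expz divff //.
by rewrite expfz_neq0 // chart_coord.
Qed.

Lemma coord_powKV i k (v : V) : chart i v ->
  coord_pow (chart i) i k v * coord_pow (chart i) i (- k) v = 1.
Proof. by move=> cv; rewrite {1}(coord_powE _ _ cv) coord_powK. Qed.

(** Such a family stands for a global section of the twist F(r), expressed through sections of F on
    the charts. *)
Definition compatible (k : nat) (r : int) (s : 'I_3 -> V -> 'rV[C]_k) : Prop :=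
  forall i j (v : V), v 0 i != 0 -> v 0 j != 0 -> v 0 i ^ r *: s i v = v 0 j ^ r *: s j v.

(** On an overlap the relation says [s i = a s j] with [a = (x_j / x_i)^r] a unit of degree 0, so
    O-linearity and commutation with restriction carry it over. *)
Lemma module_iso_compatible k m (F : presheaf R k) (G : presheaf R m) phi r s :
  module_presheaf F -> module_iso_map F G phi ->
  (forall i, F (chart i) (s i)) -> compatible r s ->
  compatible r (fun i => phi (chart i) (s i)).
Proof.
move=> [_ _ Fres] [_ _ mul res] Fs cs i j v vi vj.
pose W := [set v : V | v != 0 /\ v 0 i * v 0 j != 0].
have oW : zariski_open W.
  exact: zariski_open_form (form_mul (form_coord R i) (form_coord R j)).
have Wc w : W w -> w 0 i != 0 /\ w 0 j != 0.
  by move=> [_]; rewrite mulf_eq0 negb_or => /andP.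
have Wi : W `<=` chart i by move=> w [w0 /(conj w0) /Wc[wi _]].
have Wj : W `<=` chart j by move=> w [w0 /(conj w0) /Wc[_ wj]].
have Wv : W v by split; rewrite ?mulf_neq0 //; apply/rV0Pn; exists i.
pose a w := coord_pow W j r w * coord_pow W i (- r) w.
have ta : twisted_section 0 W a.
  rewrite -(subrr r); by apply: ts_mul; apply: ts_coord_pow => w /Wc[].
have e : restriction W (s i) = fun w => a w *: restriction W (s j) w.
  apply/funext => w; have [Ww|nW] := pselect (W w); last first.
    by rewrite !restriction_out // scaler0.
  rewrite !restriction_in // /a !coord_powE //; have [wi wj] := Wc w Ww.
  by rewrite mulrC -scalerA -(cs i j w) // scalerA -expfzDr // addNr scale1r.
have := res _ _ (zariski_open_chart i) oW Wi _ (Fs i).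
rewrite e mul //; last exact: Fres Wj (Fs j).
rewrite (res _ _ (zariski_open_chart j) oW Wj _ (Fs j)).
move=> /(congr1 (@^~ v)); rewrite !restriction_in // /a !coord_powE // => <-.
by rewrite scalerA mulrCA -invr_expz divff ?mulr1 // expfz_neq0.
Qed.

Definition glue (k : nat) (r : int) (s : 'I_3 -> V -> 'rV[C]_k) (v : V) : 'rV[C]_k :=
  if [pick i | v 0 i != 0] is Some i then v 0 i ^ r *: s i v else 0.

Lemma glueE k r (s : 'I_3 -> V -> 'rV[C]_k) i (v : V) : compatible r s -> v 0 i != 0 ->
  glue r s v = v 0 i ^ r *: s i v.
Proof.
move=> cs vi; rewrite /glue; case: pickP => [j vj|/(_ i)]; last by rewrite vi.
exact: cs.
Qed.

Lemma ts_glue k r d (s : 'I_3 -> V -> 'rV[C]_k) j : compatible r s ->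
  (forall i, twisted_section d (chart i) (fun v => s i v 0 j)) ->
  twisted_section (r + d) punctured (fun v => glue r s v 0 j).
Proof.
move=> cs hs; apply/twisted_sectionP; split=> [v /negP|v v0].
  rewrite negbK /glue => /eqP ->; case: pickP => [i|_]; rewrite mxE //.
  by rewrite eqxx.
have /rV0Pn[i vi] := v0.
have /twisted_sectionP[_ /(_ v (coord_chart vi))] :=
  ts_mul (ts_coord_pow r (@chart_coord i)) (hs i).
move=> [P [Q [m [e [hP hQ me Qv sPQ]]]]].
(* The extra coordinate in numerator and denominator confines the formula to chart [i], where it is
   known. *)
exists (fun w : V => w 0 i * P w), (fun w : V => w 0 i * Q w), (1 + m)%N, (1 + e)%N; split.
- by apply: form_mul => //; apply: form_coord.
- by apply: form_mul => //; apply: form_coord.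
- by rewrite !PoszD me addrA.
- by rewrite mulf_neq0.
move=> w w0; rewrite mulf_eq0 negb_or => /andP[wi Qw].
have cw := coord_chart wi.
rewrite (glueE cs wi) mxE -mulf_div divff // mul1r -sPQ //.
by rewrite coord_powE.
Qed.

Lemma row2_decomp (u : 'rV[C]_2) : u = u 0 0 *: delta_mx 0 0 + u 0 1 *: delta_mx 0 1.
Proof.
apply/rowP => -[[|[|//]] hk]; rewrite !mxE /= ?mulr0 ?mulr1 ?addr0 ?add0r;
  by congr (u 0 _); apply/val_inj.
Qed.

(** [t1] and [t2] are the glued images of the basis vectors. To decompose a syzygy [p] of degree
    [r], it is divided by x_i^r on each chart, mapped to the sum of twists, and its two coordinates
    are glued back in degrees [r - alpha] and [r - beta]. *)
Lemma transport_sections (f : {mpoly C[3]}) (alpha beta : int) :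
  module_iso (jacobian_kernel f) (sum_twists (- alpha) (- beta)) ->
  exists t1 t2 : V -> V,
    [/\ forall j, twisted_section alpha punctured (fun v => t1 v 0 j),
        forall j, twisted_section beta punctured (fun v => t2 v 0 j),
        forall v, v != 0 -> dir_deriv f (t1 v) v = 0,
        forall v, v != 0 -> dir_deriv f (t2 v) v = 0 &
        forall (r : int) (p : V -> V),
          (forall j, twisted_section r punctured (fun v => p v 0 j)) ->
          (forall v, v != 0 -> dir_deriv f (p v) v = 0) ->
          exists a b, [/\ twisted_section (r - alpha) punctured a,
            twisted_section (r - beta) punctured b &
            forall v, v != 0 -> p v = a v *: t1 v + b v *: t2 v]].
Proof.
move=> [phi isophi].
have MK := module_presheaf_jacobian_kernel f.
have MS := @module_presheaf_sum_twists R (- alpha) (- beta).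
have [psi isopsi psiphi] := module_iso_map_inv MK MS isophi.
have [bij add mul res] := isopsi.
have [phibij _ _ _] := isophi.
have [Sadd Smul _] := MS.
pose e1 i v : 'rV[C]_2 := coord_pow (chart i) i (- alpha) v *: delta_mx 0 0.
pose e2 i v : 'rV[C]_2 := coord_pow (chart i) i (- beta) v *: delta_mx 0 1.
have tcp i k : twisted_section k (chart i) (coord_pow (chart i) i k).
  by apply: ts_coord_pow => v [].
have tz i k : twisted_section k (chart i) (fun=> 0).
  by have := ts_scale 0 (tcp i k); under eq_fun do rewrite mul0r.
have S1 i : sum_twists (- alpha) (- beta) (chart i) (e1 i).
  by split; under eq_fun do rewrite !mxE ?mulr1 ?mulr0.
have S2 i : sum_twists (- alpha) (- beta) (chart i) (e2 i).
  by split; under eq_fun do rewrite !mxE ?mulr1 ?mulr0.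
have c1 : compatible alpha e1.
  move=> i j v /coord_chart vi /coord_chart vj.
  by rewrite /e1 !scalerA (coord_powK _ vi) (coord_powK _ vj).
have c2 : compatible beta e2.
  move=> i j v /coord_chart vi /coord_chart vj.
  by rewrite /e2 !scalerA (coord_powK _ vi) (coord_powK _ vj).
pose E1 i := psi (chart i) (e1 i); pose E2 i := psi (chart i) (e2 i).
have Kpsi i s : sum_twists (- alpha) (- beta) (chart i) s ->
    jacobian_kernel f (chart i) (psi (chart i) s).
  by move=> hs; have [+ _ _] := bij _ (zariski_open_chart i); apply.
have K1 i := Kpsi i _ (S1 i); have K2 i := Kpsi i _ (S2 i).
have C1 : compatible alpha E1 := module_iso_compatible MS isopsi S1 c1.
have C2 : compatible beta E2 := module_iso_compatible MS isopsi S2 c2.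
have glue_syz r E : compatible r E -> (forall i, jacobian_kernel f (chart i) (E i)) ->
    forall v, v != 0 -> dir_deriv f (glue r E v) v = 0.
  move=> cE kE v /rV0Pn[i vi]; rewrite (glueE cE vi) dir_derivZ.
  by have [_ /(_ v (coord_chart vi)) h] := kE i; rewrite /dir_deriv h mulr0.
exists (glue alpha E1), (glue beta E2); split.
- by move=> j; rewrite -[X in twisted_section X _ _]addr0; apply: ts_glue => // i; case: (K1 i).
- by move=> j; rewrite -[X in twisted_section X _ _]addr0; apply: ts_glue => // i; case: (K2 i).
- exact: glue_syz.
- exact: glue_syz.
move=> r p hp kp.
pose s i v := coord_pow (chart i) i (- r) v *: p v.
have Ks i : jacobian_kernel f (chart i) (s i).
  split=> [j|v [v0 vi]]; last first.
    by have := dir_derivZ f (coord_pow (chart i) i (- r) v) (p v) v; rewrite kp // mulr0.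
  have cP : chart i `<=` punctured by move=> v [].
  have := ts_mul (tcp i (- r)) (ts_restrict cP (hp j)); rewrite addNr.
  set t := (X in twisted_section _ _ X) => ht.
  suff -> : (fun v => s i v 0 j) = t by [].
  apply/funext => v; rewrite /s mxE /t; have [cv|ncv] := pselect (chart i v).
    by rewrite patchT ?inE.
  by rewrite coord_pow_out // !mul0r.
have cs : compatible r s.
  move=> i j v /coord_chart vi /coord_chart vj.
  by rewrite /s !scalerA (coord_powK _ vi) (coord_powK _ vj).
pose g i := phi (chart i) (s i).
have Sg i : sum_twists (- alpha) (- beta) (chart i) (g i).
  by have [+ _ _] := phibij _ (zariski_open_chart i); apply.
have cg : compatible r g := module_iso_compatible MK isophi Ks cs.
exists (fun v => glue r g v 0 0), (fun v => glue r g v 0 1); split.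
- by apply: ts_glue => // i; case: (Sg i).
- by apply: ts_glue => // i; case: (Sg i).
move=> v /rV0Pn[i vi]; have cv := coord_chart vi.
(* Linearity of [psi] only concerns scalars of degree 0, so a power of x_i moves between the
   coordinate and the basis section. *)
pose A w := g i w 0 0 * coord_pow (chart i) i alpha w.
pose B w := g i w 0 1 * coord_pow (chart i) i beta w.
have [g0 g1] := Sg i.
have tA : twisted_section 0 (chart i) A by rewrite -(addNr alpha); apply: ts_mul.
have tB : twisted_section 0 (chart i) B by rewrite -(addNr beta); apply: ts_mul.
have eg : g i = fun w => A w *: e1 i w + B w *: e2 i w.
  apply/funext => w; have [cw|nw] := pselect (chart i w); last first.
    rewrite [g i w]row2_decomp /A /B (ts_out g0 nw) (ts_out g1 nw).
    by rewrite !mul0r !scale0r.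
  rewrite /e1 /e2 !scalerA /A /B -[g i w 0 0 * _ * _]mulrA -[g i w 0 1 * _ * _]mulrA.
  by rewrite !(coord_powKV _ cw) !mulr1; apply: row2_decomp.
have esi : s i = fun w => A w *: E1 i w + B w *: E2 i w.
  rewrite -(psiphi _ (zariski_open_chart i) _ (Ks i)) -/(g i) eg.
  have oi := zariski_open_chart i.
  rewrite (add _ oi _ _ (Smul _ _ _ tA (S1 i)) (Smul _ _ _ tB (S2 i))).
  by rewrite (mul _ oi _ _ tA (S1 i)) (mul _ oi _ _ tB (S2 i)).
have -> : p v = v 0 i ^ r *: s i v.
  by rewrite /s scalerA (coord_powK _ cv) scale1r.
rewrite esi (glueE cg vi) (glueE C1 vi) (glueE C2 vi) /A /B !mxE.
rewrite !(coord_powE _ _ cv).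
by rewrite scalerDr !scalerA !mulrA.
Qed.

End Charts.

(** * Generators of a free kernel and zeros of a low-degree syzygy *)

Section NonfreeCriterion.
Variable R : realType.
Local Notation C := R[i].
Local Notation V := 'rV[C]_3.
Local Notation punctured := [set v : V | v != 0].
Implicit Types (L : seq V) (u v w : V).

Definition cross (a b : V) : V := \row_j
  (if j == 0 then a 0 1 * b 0 2%:R - a 0 2%:R * b 0 1
   else if j == 1 then a 0 2%:R * b 0 0 - a 0 0 * b 0 2%:R
   else a 0 0 * b 0 1 - a 0 1 * b 0 0).

Lemma dot_cross a b : dot a (cross a b) = 0.
Proof. by rewrite dotE !mxE /=; ring. Qed.

(** For [g] the gradient, the last factor is a multiple of the equation by Euler; so off the lines
    suitable [q], [q'] give Koszul syzygies independent together with [v]. *)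
Lemma det3_cross v g q q' :
  det3 v (cross g q) (cross g q') = det3 g q q' * dot g v.
Proof. by rewrite dotE /det3 !mxE /=; ring. Qed.

Lemma det3_comb v t1 t2 a b a' b' :
  det3 v (a *: t1 + b *: t2) (a' *: t1 + b' *: t2) =
  (a * b' - a' * b) * det3 v t1 t2.
Proof. by rewrite /det3 !mxE; ring. Qed.

Lemma det3_delta_neq0 (g : V) : g != 0 -> exists q q', det3 g q q' != 0.
Proof.
move=> /rV0Pn[j]; elim/ord3_ind: j => gj.
- by exists (delta_mx 0 1), (delta_mx 0 2%:R); rewrite /det3 !mxE /=
    !(mulr0, mulr1, subr0, sub0r, addr0, add0r, mul0r, oppr0).
- exists (delta_mx 0 0), (delta_mx 0 2%:R); rewrite /det3 !mxE /=
    !(mulr0, mulr1, subr0, sub0r, addr0, add0r, mul0r, oppr0).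
  by rewrite oppr_eq0.
- by exists (delta_mx 0 0), (delta_mx 0 1); rewrite /det3 !mxE /=
    !(mulr0, mulr1, subr0, sub0r, addr0, add0r, mul0r, oppr0).
Qed.

(* The Koszul syzygies [grad f x q] span the fibre of the kernel wherever
   [grad f] is nonzero, so two generators are independent there. *)
Lemma generators_independent L (t1 t2 : V -> V) v : L != [::] ->
  line_prod L v != 0 -> v != 0 ->
  (forall (r : int) (p : V -> V),
     (forall j, twisted_section r punctured (fun v => p v 0 j)) ->
     (forall v, v != 0 -> dir_deriv (lines_poly L) (p v) v = 0) ->
     exists a b, forall v, v != 0 -> p v = a v *: t1 v + b v *: t2 v) ->
  det3 v (t1 v) (t2 v) != 0.
Proof.
move=> L0 Lv v0 gen; apply/eqP => D0.
pose g := grad (lines_poly L).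
have koszul q : exists a b, cross (g v) q = a *: t1 v + b *: t2 v.
  pose p := restriction punctured (fun w => cross (g w) q).
  have hp j : twisted_section (size L).-1%:Z punctured (fun w => p w 0 j).
    rewrite /p restriction_coord; apply: ts_form; under eq_fun do rewrite mxE.
    have hg k : form_fun (size L).-1 (fun w => g w 0 k).
      by under eq_fun do rewrite mxE; apply: form_grad.
    have hgc k c : form_fun (size L).-1 (fun w => g w 0 k * c).
      by under eq_fun do rewrite mulrC; apply: form_scale.
    by case: (j == 0); last case: (j == 1); apply: form_sub.
  have [|a [b e]] := gen _ p hp.
    by move=> w w0; rewrite dir_derivE /p restriction_in // dot_cross.
  by exists (a v), (b v); rewrite -e // /p restriction_in.
have gv : dot (g v) v = (size L)%:R * line_prod L v by rewrite -dir_derivE dir_deriv_euler.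
have gv0 : dot (g v) v != 0 by rewrite gv mulf_neq0 // pnatr_eq0 size_eq0.
have g0 : g v != 0.
  by apply: contra_neq gv0 => ->; rewrite -(scale0r 0) dotZl mul0r.
have [q [q' /eqP[]]] := det3_delta_neq0 g0.
have [a [b e]] := koszul q; have [a' [b' e']] := koszul q'.
have := det3_cross v (g v) q q'; rewrite e e' det3_comb D0 mulr0.
by move=> /esym/eqP; rewrite mulf_eq0 (negPf gv0) orbF => /eqP.
Qed.

Lemma ts_det3 (alpha beta : int) (t1 t2 : V -> V) :
  (forall j, twisted_section alpha punctured (fun v => t1 v 0 j)) ->
  (forall j, twisted_section beta punctured (fun v => t2 v 0 j)) ->
  twisted_section (1 + (alpha + beta)) punctured (fun v => det3 v (t1 v) (t2 v)).
Proof.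
move=> h1 h2; have hx j : twisted_section 1 punctured (fun v => v 0 j).
  have := ts_form punctured (form_coord R j).
  set t := (X in twisted_section _ _ X) => ht.
  suff -> : (fun v : V => v 0 j) = t by [].
  apply/funext => v; rewrite /t /patch; case: ifPn => //.
  by rewrite notin_setE /= => /negP; rewrite negbK => /eqP ->; rewrite mxE.
have h i j : twisted_section (alpha + beta) punctured
    (fun v => t1 v 0 i * t2 v 0 j - t1 v 0 j * t2 v 0 i).
  by apply: ts_sub; apply: ts_mul.
by apply: ts_add; first apply: ts_sub; apply: ts_mul.
Qed.

(* A line through [p] in general position meets the lines of [L] in distinct
   points. *)
Lemma ts_vanish_on_lines L (d : int) s p : line_family L -> (1 < size L)%N ->
  twisted_section d punctured s -> d < (size L)%:Z -> line_prod L p != 0 ->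
  (forall v l, v != 0 -> l \in L -> dot l v = 0 -> s v = 0) -> s p = 0.
Proof.
move=> hL sL hs dL Lp s0; have [L0 uL Lnp] := hL.
have lp l : l \in L -> dot l p != 0.
  by move=> lL; move: Lp; rewrite line_prod_neq0 => /allP; apply.
(* This form defines the line joining [p] to the intersection of the two given lines. If [w] avoids
   it, the line through [p] and [w] meets them at distinct parameters. *)
pose m (ll : V * V) := dot ll.1 p *: ll.2 - dot ll.2 p *: ll.1.
pose M := L ++ [seq m ll | ll <- [seq (l, l') | l <- L, l' <- L] & ll.1 != ll.2].
have [|w] := @line_prod_generic R M.
  move=> k; rewrite mem_cat => /orP[/L0 //|/mapP[[l l']]].
  rewrite mem_filter /= => /andP[ll /allpairsP[[x y] /= [xL yL [e1 e2]]]] ->.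
  subst x y; rewrite /m subr_eq0 /= ; apply/eqP => e.
  move/eqP: (Lnp l l' xL yL ll (dot l p / dot l' p)); apply.
  by rewrite mulrC -scalerA e scalerA mulVf ?scale1r // lp.
rewrite line_prod_neq0 all_cat => /andP[/allP Lw /allP Mw].
have mw l l' : l \in L -> l' \in L -> l != l' ->
    dot l p * dot l' w != dot l' p * dot l w.
  move=> lL lL' ll; have := Mw (m (l, l')).
  rewrite map_f => [/(_ isT)|]; last first.
    by rewrite mem_filter /= ll; apply/allpairsP; exists (l, l').
  by rewrite /m /= dotC dotBr !dotZr ![dot w _]dotC subr_eq0.
have pw : independent p w.
  move=> x y e; have y0 : y = 0.
    apply/eqP/negP => /negP y0.
    have yw l : y * dot l w = - (x * dot l p).
      apply/eqP; rewrite -addr_eq0 addrC -!dotZr -dotDr e.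
      by rewrite -(scale0r 0) dotZr mul0r.
    have [l0 [l1 [lL0 lL1 ll]]] : exists l0 l1, [/\ l0 \in L, l1 \in L & l0 != l1].
      case: L sL uL {hL dL Lp s0 Lnp L0 M Lw Mw lp mw} => [//|l0 [//|l1 L]] _ /= /andP[l0L _].
      exists l0, l1; rewrite !inE !eqxx orbT; split=> //.
      by apply: contraNneq l0L => ->; rewrite mem_head.
    move/eqP: (mw l0 l1 lL0 lL1 ll); apply; apply: (mulfI y0).
    by rewrite mulrCA yw [RHS]mulrCA yw; ring.
  move: e; rewrite y0 scale0r addr0 => /eqP; rewrite scaler_eq0 => /orP[/eqP //|/eqP p0].
  case: L sL lp {uL Lnp L0 hL dL Lp s0 M Lw Mw mw} => // l0 L _ lp.
  by have := lp l0 (mem_head _ _); rewrite p0 -(scale0r 0) dotZr mul0r eqxx.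
pose t l := - (dot l p / dot l w).
have zt l : l \in L -> s (p + t l *: w) = 0.
  move=> lL; apply: (s0 _ l) => //; first exact: independent_neq0.
  by rewrite dotDr dotZr /t mulNr mulfVK ?subrr // Lw.
have := ts_line_vanish hs pw (ts := map t L) _ _ _ 0.
rewrite scale0r addr0; apply.
- rewrite map_inj_in_uniq // => l l' lL lL' /oppr_inj/eqP.
  rewrite eqr_div ?Lw // => e; apply/eqP; apply: contraTT e => ll.
  exact: mw.
- by rewrite size_map.
- by move=> _ /mapP[l lL ->]; apply: zt.
Qed.

Lemma nonfree_criterion L r (psi : V -> V) p u w : line_family L ->
  (r + r + 1 < size L)%N ->
  (forall j, form_fun r (fun v => psi v 0 j)) ->
  (forall v, dir_deriv (lines_poly L) (psi v) v = 0) ->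
  line_prod L p != 0 -> psi p = 0 -> independent u w ->
  (forall x y, x *: u + y *: w != 0 -> psi (x *: u + y *: w) != 0) ->
  forall alpha beta : int,
    ~ module_iso (jacobian_kernel (lines_poly L)) (sum_twists (- alpha) (- beta)).
Proof.
move=> hL rL hpsi kpsi Lp psip uw psin0 alpha beta iso.
have sL : (1 < size L)%N by apply: leq_ltn_trans rL; rewrite leq_addl.
have L0 : L != [::] by rewrite -size_eq0 -lt0n ltnW.
have p0 : p != 0.
  apply: contraNneq Lp => ->; rewrite /line_prod; case: L L0 {hL rL kpsi iso sL} => // l L _.
  by rewrite big_cons -(scale0r 0) dotZr !mul0r.
have [t1 [t2 [h1 h2 k1 k2 gen]]] := transport_sections iso.
have D0 : det3 p (t1 p) (t2 p) != 0.
  apply: (generators_independent L0 Lp p0) => k q hq kq.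
  by have [a [b [_ _ e]]] := gen k q hq kq; exists a, b.
have deg : ~~ (1 + (alpha + beta) < (size L)%:Z).
  apply: contra D0 => small; apply/eqP.
  apply: (ts_vanish_on_lines hL sL (ts_det3 h1 h2) small Lp) => v l v0 lL lv.
  have [Ln0 _ _] := hL.
  apply: (det3_perp (Ln0 l lL) lv).
    exact: (section_tangent hL (zariski_open_punctured R) h1).
  exact: (section_tangent hL (zariski_open_punctured R) h2).
have tspsi j : twisted_section r punctured (fun v => restriction punctured psi v 0 j).
  by rewrite restriction_coord; apply: ts_form.
have [|a [b [ha hb e]]] := gen r _ tspsi.
  by move=> v v0; rewrite restriction_in.
have {}e v : v != 0 -> psi v = a v *: t1 v + b v *: t2 v.
  by move=> v0; rewrite -e // restriction_in.
have [ap bp] : a p = 0 /\ b p = 0.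
  apply: (det3_indep D0); rewrite -(e p p0) psip.
  by rewrite !scale0r addr0.
(* Either of [alpha], [beta] may be the one exceeding [r], so the argument is stated for a
   coefficient [y] of negative degree and a coefficient [x] vanishing at [p]. *)
have key (x y : V -> C) (s s' : V -> V) (d d' : int) :
    twisted_section d punctured x -> twisted_section d' punctured y ->
    x p = 0 -> d' < 0 -> (forall v, v != 0 -> psi v = x v *: s v + y v *: s' v) -> False.
  move=> hx hy xp d'0 exy.
  have indep v : v != 0 -> psi v != 0 -> independent p v.
    move=> v0 psiv c c' h; have c'0 : c' = 0.
      apply/eqP; apply: contraNT psiv => c'0.
      have -> : v = (- c / c') *: p.
        apply: (scalerI c'0); rewrite scalerA mulrCA divff // mulr1 scaleNr.
        by apply/eqP; rewrite -addr_eq0 addrC h.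
      apply/eqP/rowP => j; rewrite (form_homog (hpsi j)) psip.
      by rewrite !mxE mulr0.
    move: h; rewrite c'0 scale0r addr0 => /eqP.
    by rewrite scaler_eq0 (negPf p0) orbF => /eqP.
  have y0 v : v != 0 -> psi v != 0 -> y v = 0.
    move=> v0 psiv; have pv := independent_sym (indep v v0 psiv).
    have := ts_line_vanish hy pv (ts := [::]) isT _ _ 0.
    by rewrite scale0r addr0; apply.
  suff [v v0 [psiv xv]] : exists2 v, v != 0 & psi v != 0 /\ x v = 0.
    by have yv := y0 v v0 psiv; move: psiv; rewrite exy // xv yv !scale0r addr0 eqxx.
  have u0 : u != 0 by have := independent_neq0 0 uw; rewrite scale0r addr0.
  have [d0|d0] := ltrP 0 d.
    have [c [c' [v0 xv]]] := ts_line_zero hx uw d0.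
    by exists (c *: u + c' *: w) => //; split=> //; apply: psin0.
  have psiu : psi u != 0.
    by have := psin0 1 0; rewrite scale0r scale1r addr0; apply.
  exists u => //; split=> //.
  (* For [d <= 0] the single zero at [p] already makes [x] vanish along any line through [p]; this
     parametrization puts [u] at parameter 1 instead of at infinity. *)
  have pu : independent p (u - p).
    move=> c c' h; have [|cc c'0] := indep u u0 psiu (c - c') c'.
      by rewrite -h scalerBl scalerBr addrA addrAC.
    by move: cc; rewrite c'0 subr0.
  have := ts_line_vanish hx pu (ts := [:: 0]) isT _ _ 1.
  rewrite scale1r addrCA subrr addr0; apply.
    exact: le_lt_trans d0 _.
  by move=> c; rewrite inE => /eqP ->; rewrite scale0r addr0.
have [lt|ge] := ltrP (r%:Z - beta) 0.
  exact: key ha hb ap lt e.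
apply: (key _ _ t2 t1 _ _ hb ha bp); last by move=> v v0; rewrite e // addrC.
by move: deg ge rL; lia.
Qed.

End NonfreeCriterion.

(** * Arrangements and their multiple points *)

Section LineSubspaces.
Variable R : realType.
Local Notation C := R[i].
Local Notation V := 'rV[C]_3.
Implicit Types (L : seq V) (l u v w : V).

Definition line_space l : {vspace V} := lker (linfun (mulmxr l^T : V -> 'rV[C]_1)).

Lemma mem_line_space l v : (v \in line_space l) = (dot l v == 0).
Proof.
have e : v *m l^T = (dot l v)%:M.
  apply/rowP => i; rewrite ord1 !mxE eqxx mulr1n.
  by apply: eq_bigr => j _; rewrite mxE mulrC.
rewrite memv_ker lfunE /= e; apply/eqP/eqP => [/rowP/(_ 0)|->].
  by rewrite !mxE eqxx mulr1n.
by apply/rowP => i; rewrite !mxE mul0rn.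
Qed.

Lemma dim_line_space l : l != 0 -> \dim (line_space l) = 2%N.
Proof.
move=> l0; pose f := linfun (mulmxr l^T : V -> 'rV[C]_1).
have := limg_ker_dim f fullv; rewrite capfv dimvf dim_matrix.
suff -> : \dim (f @: fullv) = 1%N by rewrite addn1 => -[].
apply/eqP; rewrite eqn_leq; apply/andP; split.
  by rewrite (leq_trans (dimvS (subvf _))) // dimvf dim_matrix.
have [u lu] := dot_neq0 l0; rewrite lt0n dimv_eq0; apply/eqP => f0.
have : f u \in (f @: fullv)%VS by apply: memv_img; apply: memvf.
rewrite f0 memv0 -memv_ker => h; have : u \in line_space l by [].
by rewrite mem_line_space lu oner_eq0.
Qed.

Lemma line_space_inj L l l' : line_family L -> l \in L -> l' \in L ->
  line_space l = line_space l' -> l = l'.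
Proof.
move=> [L0 _ Lp] lL lL' e; apply/eqP/negP => /negP ll.
have [w lw] := nonproportional_witness (L0 l' lL') (Lp l l' lL lL' ll).
by rewrite -mem_line_space e mem_line_space lw eqxx.
Qed.

Definition arrangement L : {fset {vspace V}} := seq_fset tt (map line_space L).

Lemma uniq_line_spaces L : line_family L -> uniq (map line_space L).
Proof.
move=> hL; have inj : {in L &, injective line_space}.
  by move=> l l' lL lL'; apply: line_space_inj hL lL lL'.
by rewrite (map_inj_in_uniq inj); case: hL.
Qed.

Lemma arrangement_perm L : line_family L ->
  perm_eq (arrangement L) (map line_space L).
Proof.
move=> hL; rewrite -[X in perm_eq _ X]undup_id ?uniq_line_spaces //.
exact: seq_fset_perm.
Qed.

Lemma arrangement_lines L : line_family L -> line_arrangement (arrangement L).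
Proof.
move=> [L0 _ _] l; rewrite seq_fsetE => /mapP[k /L0 k0 ->].
exact: dim_line_space.
Qed.

Lemma card_arrangement L : line_family L -> #|` arrangement L| = size L.
Proof. by move=> hL; rewrite (perm_size (arrangement_perm hL)) size_map. Qed.

Lemma linear_poly_homog l : linear_poly l \is 1.-homog.
Proof.
apply: rpred_sum => j _; apply: dhomogZ.
by rewrite dhomogX; apply/eqP; exact: mdeg1.
Qed.

Lemma linear_poly_neq0 l : l != 0 -> linear_poly l != 0.
Proof.
move=> /dot_neq0[u lu]; apply: contra_eq_neq lu => l0.
by rewrite -evalv_linear_poly l0 /evalv meval0 eq_sym oner_eq0.
Qed.

Lemma arrangement_equation L : line_family L ->
  defining_equation (arrangement L) (lines_poly L).
Proof.
move=> hL; have [L0 _ _] := hL.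
(* Equations are indexed by subspaces, so the form is recovered from the position of its kernel in
   the list. *)
exists (fun W => linear_poly (nth 0 L (index W (map line_space L)))).
  move=> W; rewrite seq_fsetE => WL; set l := nth _ _ _.
  have sl : (index W (map line_space L) < size L)%N by rewrite -(size_map line_space) index_mem.
  have lL : l \in L by apply: mem_nth.
  have lW : line_space l = W by rewrite -(nth_map 0 0%VS) // nth_index.
  split; [exact: linear_poly_homog|exact/linear_poly_neq0/L0|].
  by move=> v; rewrite -lW mem_line_space evalv_linear_poly => /eqP.
rewrite (perm_big _ (arrangement_perm hL)) big_map /=.
rewrite /lines_poly !big_seq; apply: eq_bigr => l lL; congr linear_poly.
apply: (line_space_inj hL lL).
  by apply: mem_nth; rewrite -(size_map line_space) index_mem map_f.
by rewrite -(nth_map 0 0%VS) ?nth_index ?map_f // -(size_map line_space) index_mem map_f.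
Qed.

Lemma homog1_linear (p : {mpoly C[3]}) : p \is 1.-homog -> exists l, p = linear_poly l.
Proof.
move=> /dhomogP hp; rewrite (mpolyE p); have: {subset msupp p <= msupp p} by [].
elim: {1 3}(msupp p) => [_|m s IH sub].
  by exists 0; rewrite big_nil /linear_poly big1 // => j _; rewrite mxE scale0r.
rewrite big_cons; have [|l ->] := IH.
  by move=> x xs; apply: sub; rewrite inE xs orbT.
have /eqP/mdeg1P[i /eqP ->] := hp m (sub m (mem_head _ _)).
exists (p@_U_(i) *: delta_mx 0 i + l).
rewrite /linear_poly [RHS](eq_bigr (fun j => (p@_U_(i) * (j == i)%:R) *: 'X_j + l 0 j *: 'X_j)).
  rewrite big_split /=; congr (_ + _); rewrite (bigD1 i) //= big1 => [|j ji].
    by rewrite eqxx mulr1 addr0.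
  by rewrite (negPf ji) mulr0 scale0r.
by move=> j _; rewrite !mxE eqxx scalerDl.
Qed.

Lemma linear_polyZ c l : linear_poly (c *: l) = c *: linear_poly l.
Proof.
by rewrite /linear_poly scaler_sumr; apply: eq_bigr => j _; rewrite mxE scalerA.
Qed.

Lemma line_equation_scale l p : l != 0 -> line_equation (line_space l) p ->
  exists2 c, c != 0 & p = c *: linear_poly l.
Proof.
move=> l0 [/homog1_linear[k ->] k0 hk].
have [[c ec]|np] := pselect (exists c, k = c *: l); last first.
  have [|w lw /eqP[]] := @nonproportional_witness _ k l l0.
    by move=> c; apply/eqP => ec; apply: np; exists c.
  by rewrite -evalv_linear_poly hk // mem_line_space lw.
exists c; last by rewrite ec linear_polyZ.
by apply: contra_neq k0 => c0; rewrite ec c0 scale0r -(scale0r 0) linear_polyZ scale0r.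
Qed.

(** Freeness asks for some defining equation, so its negation must deal with all of them; each
    factor is determined by its line up to a scalar. *)
Lemma defining_equation_scale L f : line_family L ->
  defining_equation (arrangement L) f -> exists2 c, c != 0 & f = c *: lines_poly L.
Proof.
move=> hL [g hg ->]; have [L0 _ _] := hL.
rewrite (perm_big _ (arrangement_perm hL)) big_map /lines_poly.
have : {subset L <= L} by [].
elim: {1 3 4}L => [_|l K IH sub].
  by exists 1; rewrite ?oner_eq0 // !big_nil scale1r.
have [|c c0 ec] := IH; first by move=> x xK; apply: sub; rewrite inE xK orbT.
have lL := sub l (mem_head _ _).
have [|d d0 ed] := line_equation_scale (L0 l lL) (hg (line_space l) _).
  by rewrite seq_fsetE map_f.
exists (d * c); first by rewrite mulf_neq0.
by rewrite !big_cons ec ed -!mul_mpolyC mpolyCM mulrACA.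
Qed.

Lemma jacobian_kernel_scale (c : C) (f : {mpoly C[3]}) : c != 0 ->
  jacobian_kernel (c *: f) = jacobian_kernel f.
Proof.
move=> c0; apply/funext => U; apply/seteqP.
have e (s : V -> V) v : \sum_(j < 3) s v 0 j * evalv (c *: f)^`M(j) v =
    c * \sum_(j < 3) s v 0 j * evalv f^`M(j) v.
  rewrite mulr_sumr; apply: eq_bigr => j _.
  by rewrite mderivZ /evalv mevalZ mulrCA.
split=> s [h1 h2]; (split; first exact: h1) => v Uv.
  by apply: (mulfI c0); rewrite mulr0 -e h2.
by rewrite e h2 ?mulr0.
Qed.

Lemma arrangement_not_free L : line_family L ->
  (forall alpha beta : int,
    ~ module_iso (jacobian_kernel (lines_poly L)) (sum_twists (- alpha) (- beta))) ->
  ~ free_arrangement (arrangement L).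
Proof.
move=> hL h [f /(defining_equation_scale hL)[c c0 ->] [alpha [beta]]].
by rewrite jacobian_kernel_scale //; apply: h.
Qed.

(** On the equation, [s] acts as the sum of the cofactors and the Euler field as the number of
    lines; this combination cancels the two. *)
Lemma euler_correction L (s : V -> V) (lk : V -> seq (V * C)) v :
  unzip1 (lk v) = L ->
  (forall p, p \in lk v -> dot p.1 (s v) = dot p.1 v * p.2) ->
  dir_deriv (lines_poly L)
    ((size L)%:R *: s v - (\sum_(p <- lk v) p.2) *: v) v = 0.
Proof.
move=> eL h; rewrite -scaleNr dir_derivD !dir_derivZ dir_deriv_euler -eL.
by rewrite (dir_deriv_lines h) eL mulrCA mulNr subrr.
Qed.

(** The Euler corrections are multiples of the first row, so determinants can be computed from the
    uncorrected fields. *)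
Lemma det3_euler v a b c d n m :
  det3 v (n *: a - c *: v) (m *: b - d *: v) = n * m * det3 v a b.
Proof. by rewrite /det3 !mxE; ring. Qed.

End LineSubspaces.

(** * Normalized coordinates and counting of points *)

Section NormalizedVectors.
Variable R : realType.
Local Notation C := R[i].
Local Notation V := 'rV[C]_3.
Implicit Types (L : seq V) (l u v w : V) (o : seq 'I_3).

Definition vec3 (x y z : C) : V := \row_j [:: x; y; z]`_j.

Lemma vec3E v : v = vec3 (v 0 0) (v 0 1) (v 0 2%:R).
Proof. by apply/rowP; elim/ord3_ind; rewrite mxE. Qed.

Lemma vec3_inj x y z x' y' z' : vec3 x y z = vec3 x' y' z' ->
  [/\ x = x', y = y' & z = z'].
Proof.
by move=> /rowP e; split; [have := e 0|have := e 1|have := e 2%:R]; rewrite !mxE.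
Qed.

Lemma dot_vec3 x y z x' y' z' :
  dot (vec3 x y z) (vec3 x' y' z') = x * x' + y * y' + z * z'.
Proof. by rewrite dotE !mxE. Qed.

(** Requiring the value 1 selects one representative per projective point. The order [o] is a
    parameter because lines are normalized from the first coordinate and points from the last. *)
Definition lead o v : C := head 0 [seq v 0 i | i <- o & v 0 i != 0].

Lemma leadZ o c v : c != 0 -> lead o (c *: v) = c * lead o v.
Proof.
move=> c0; rewrite /lead; elim: o => [|i o IH] /=; first by rewrite mulr0.
by rewrite !mxE mulf_eq0 (negPf c0) /=; case: ifP => //= _; rewrite mxE.
Qed.

Lemma lead_neq0 o v : lead o v = 1 -> v != 0.
Proof.
move=> v1; apply/eqP => v0; move: v1; rewrite v0 /lead.
rewrite (eq_filter (a2 := pred0)) ?filter_pred0 /=; last by move=> i /=; rewrite mxE eqxx.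
by move/esym/eqP; rewrite oner_eq0.
Qed.

Lemma lead_proportional o u v c : lead o u = 1 -> lead o v = 1 -> u = c *: v -> u = v.
Proof.
move=> u1 v1 e; have c0 : c != 0.
  by apply: contra_neq (lead_neq0 u1) => c0; rewrite e c0 scale0r.
by move: u1; rewrite e leadZ // v1 mulr1 => ->; rewrite scale1r.
Qed.

Lemma line_family_lead o L : uniq L -> (forall l, l \in L -> lead o l = 1) ->
  line_family L.
Proof.
move=> uL hL; split=> // [l /hL/lead_neq0 //|l l' lL lL' ll c].
apply: contra_neq ll; exact: (lead_proportional (hL l lL) (hL l' lL')).
Qed.

Definition multiplicity L v : nat := count (fun l => dot l v == 0) L.

Lemma card_lines_through L v : line_family L ->
  #|` [fset l in arrangement L | (<[v]> <= l)%VS]%fset| = multiplicity L v.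
Proof.
move=> hL; pose K := [seq line_space l | l <- L & dot l v == 0].
have -> : [fset l in arrangement L | (<[v]> <= l)%VS]%fset = seq_fset tt K.
  apply/fsetP => W; rewrite !inE !seq_fsetE; apply/andP/mapP.
    move=> [/mapP[l lL ->]]; rewrite -memvE mem_line_space => lv.
    by exists l; rewrite // mem_filter lv.
  move=> [l]; rewrite mem_filter => /andP[lv lL] ->.
  by rewrite map_f // -memvE mem_line_space.
rewrite size_seq_fset undup_id ?size_map ?size_filter //.
apply: subseq_uniq (uniq_line_spaces hL).
by rewrite /K; apply: map_subseq; apply: filter_subseq.
Qed.

Lemma dim1_lead o (P : {vspace V}) : (forall i, i \in o) -> \dim P = 1%N ->
  exists2 v, lead o v = 1 & P = <[v]>%VS.
Proof.
move=> ho dP; set u := vpick P.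
have u0 : u != 0 by rewrite vpick0 -dimv_eq0 dP.
have lu : lead o u != 0.
  rewrite /lead; have /rV0Pn[i ui] := u0.
  have : has (fun i => u 0 i != 0) o by apply/hasP; exists i.
  by elim: o {ho} => //= j o IH; case: ifP => //= uj; exact: IH.
exists ((lead o u)^-1 *: u); first by rewrite leadZ ?invr_eq0 // mulVf.
apply/esym/eqP; rewrite eqEdim dP; apply/andP; split.
  by rewrite -memvE memvZ // memv_pick.
by rewrite dim_vline scaler_eq0 negb_or invr_eq0 lu u0.
Qed.

Lemma vline_lead_inj o u v : lead o u = 1 -> lead o v = 1 ->
  <[u]>%VS = <[v]>%VS -> u = v.
Proof.
move=> u1 v1 e; have : u \in <[v]>%VS by rewrite -e memv_line.
by move=> /vlineP[c]; apply: lead_proportional u1 v1.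
Qed.

(** Reduces the cardinality of a set of subspaces to a count in an explicit list, which may also
    contain points of smaller multiplicity. *)
Lemma t_count o L N i : line_family L -> (forall j, j \in o) -> uniq N ->
  (forall v, v \in N -> lead o v = 1) ->
  (forall v, lead o v = 1 -> (2 <= multiplicity L v)%N -> v \in N) ->
  (2 <= i)%N -> t_ (arrangement L) i = count (fun v => multiplicity L v == i) N.
Proof.
move=> hL ho uN hN hall i2.
pose K := [seq <[v]>%VS | v <- N & multiplicity L v == i].
have uK : uniq K.
  rewrite map_inj_in_uniq ?filter_uniq // => u v.
  rewrite !mem_filter => /andP[_ /hN u1] /andP[_ /hN v1].
  exact: vline_lead_inj u1 v1.
have -> : t_ (arrangement L) i = #|` fset_set [set` seq_fset tt K]|.
  congr (#|` fset_set _ |); apply/seteqP; split=> P /=.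
    move=> [dP mP]; have [v v1 eP] := dim1_lead ho dP.
    move: mP; rewrite eP card_lines_through // => mv.
    suff : <[v]>%VS \in seq_fset tt K by [].
    rewrite seq_fsetE; apply/mapP; exists v => //.
    by rewrite mem_filter mv eqxx hall // mv.
  move=> PK; have : P \in seq_fset tt K by [].
  rewrite seq_fsetE => /mapP[v]; rewrite mem_filter => /andP[/eqP mv vN] ->.
  by split; rewrite ?card_lines_through // dim_vline (lead_neq0 (hN v vN)).
by rewrite set_fsetK size_seq_fset undup_id // size_map size_filter.
Qed.

End NormalizedVectors.

(** * Triangular arrangements *)

Section Triangular.
Variable R : realType.
Local Notation C := R[i].
Local Notation V := 'rV[C]_3.
Variable S : seq C.
Hypothesis uS : uniq S.
Hypothesis S0 : 0 \notin S.

Definition tri_lines : seq V :=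
  [:: vec3 1 0 0; vec3 0 1 0; vec3 0 0 1] ++
  [seq vec3 1 (- c) 0 | c <- S] ++ [seq vec3 0 1 (- a) | a <- S] ++
  [seq vec3 1 0 (- d) | d <- S].

Lemma mem_S_neq0 c : c \in S -> c != 0.
Proof. by apply: contraTneq => ->. Qed.

(** The lists below are concatenations whose pieces are told apart by which coordinates vanish; [P]
    is the separating property. *)
Lemma uniq_cat_pred (T : eqType) (P : pred T) (s t : seq T) :
  uniq s -> uniq t -> all P s -> all (predC P) t -> uniq (s ++ t).
Proof.
move=> us ut /allP Ps /allP Pt; rewrite cat_uniq us ut andbT /=.
by apply/hasPn => x xt; apply/negP => /Ps; apply/negP; apply: Pt.
Qed.

Lemma lead_vec3_fwd (x y z : C) : lead [:: 0; 1; 2%:R] (vec3 x y z) =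
  if x != 0 then x else if y != 0 then y else if z != 0 then z else 0.
Proof. by rewrite /lead /= !mxE /=; do 3?[case: ifP => _ //=; rewrite ?mxE //]. Qed.

Lemma lead_vec3_bwd (x y z : C) : lead [:: 2%:R; 1; 0] (vec3 x y z) =
  if z != 0 then z else if y != 0 then y else if x != 0 then x else 0.
Proof. by rewrite /lead /= !mxE /=; do 3?[case: ifP => _ //=; rewrite ?mxE //]. Qed.

Lemma tri_line_family : line_family tri_lines.
Proof.
apply: (@line_family_lead _ [:: 0; 1; 2%:R]).
  pose nz j (v : V) := v 0 j != 0.
  pose P1 v := addn (addn (nz 0 v) (nz 1 v)) (nz 2%:R v) == 1%N.
  rewrite /tri_lines; apply: (@uniq_cat_pred V P1).
  - rewrite /= !inE !negb_or /= andbT -!andbA; apply/and3P; split.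
    + by apply/eqP => /vec3_inj[/eqP]; rewrite oner_eq0.
    + by apply/eqP => /vec3_inj[/eqP]; rewrite oner_eq0.
    + by apply/eqP => /vec3_inj[_ /eqP]; rewrite oner_eq0.
  - apply: (@uniq_cat_pred V (fun v : V => ~~ nz 2%:R v)).
    + by rewrite map_inj_uniq // => c d /vec3_inj[_ /oppr_inj].
    + apply: (@uniq_cat_pred V (fun v : V => ~~ nz 0 v)).
      * by rewrite map_inj_uniq // => c d /vec3_inj[_ _ /oppr_inj].
      * by rewrite map_inj_uniq // => c d /vec3_inj[_ _ /oppr_inj].
      * by apply/allP => _ /mapP[c _ ->]; rewrite /nz mxE eqxx.
      * by apply/allP => _ /mapP[c _ ->]; rewrite /nz /= mxE oner_eq0.
    + by apply/allP => _ /mapP[c _ ->]; rewrite /nz mxE eqxx.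
    + rewrite all_cat; apply/andP; split; apply/allP => _ /mapP[c cS ->];
        by rewrite /nz /= mxE /= oppr_eq0 (mem_S_neq0 cS).
  - by rewrite /= /P1 /nz !mxE /= !eqxx !oner_eq0.
  - rewrite !all_cat; apply/and3P; split; apply/allP => _ /mapP[c cS ->];
      by rewrite /P1 /nz /= !mxE /= oppr_eq0 (mem_S_neq0 cS) !oner_eq0 eqxx.
move=> l; rewrite !mem_cat !inE => /or4P[|/mapP[c _ ->]|/mapP[c _ ->]|/mapP[c _ ->]].
- by case/or3P => /eqP ->; rewrite lead_vec3_fwd ?eqxx ?oner_eq0.
- by rewrite lead_vec3_fwd oner_eq0.
- by rewrite lead_vec3_fwd eqxx oner_eq0.
- by rewrite lead_vec3_fwd oner_eq0.
Qed.

(** The number of lines of one pencil, outside the triangle, through a point with these two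
    coordinates. *)
Definition roots_count (x y : C) : nat := count (fun c => x == c * y) S.

Lemma roots_count0 x : roots_count x 0 = muln (x == 0) (size S).
Proof.
rewrite /roots_count; under eq_count do rewrite mulr0.
by case: eqP => _; rewrite ?count_predT ?count_pred0 ?mul1n.
Qed.

Lemma roots_countE x y : y != 0 -> roots_count x y = (x / y \in S).
Proof.
move=> y0; rewrite -(count_uniq_mem _ uS); apply: eq_count => c /=.
by rewrite -(can2_eq (mulfVK y0) (mulfK y0)) eq_sym.
Qed.

Lemma multiplicity_tri x y z : multiplicity tri_lines (vec3 x y z) =
  addn (addn (x == 0) (addn (y == 0) (z == 0)))
    (addn (roots_count x y) (addn (roots_count y z) (roots_count x z))).
Proof.
rewrite /multiplicity /tri_lines !count_cat /= !count_map.
rewrite !dot_vec3 !mul1r !mul0r !addr0 !add0r addn0; congr (_ + (_ + (_ + _)))%N.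
- by apply: eq_count => c /=; rewrite dot_vec3 mul1r mul0r addr0 mulNr subr_eq0.
- by apply: eq_count => c /=; rewrite dot_vec3 mul1r mul0r add0r mulNr subr_eq0.
- by apply: eq_count => c /=; rewrite dot_vec3 mul1r mul0r addr0 mulNr subr_eq0.
Qed.

Definition is_ratio (p : C * C) := has (fun c => p.1 == c * p.2) S.

Lemma is_ratioE d a : a != 0 -> is_ratio (d, a) = (d / a \in S).
Proof.
move=> a0; rewrite /is_ratio has_count -/(roots_count d a) roots_countE //.
by rewrite lt0b.
Qed.

Definition pairs : seq (C * C) := [seq (c, a) | c <- S, a <- S].

(** The vertices of the triangle; the points where a side meets a line of the opposite pencil; then,
    off the triangle, the points on a [c]-line and an [a]-line (triple when the product is in [S]),
    those on a [d]-line and an [a]-line only, and those on a [d]-line and a [c]-line only. *)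
Definition multiple_points : seq V :=
  [:: vec3 1 0 0; vec3 0 1 0; vec3 0 0 1] ++
  ([seq vec3 c 1 0 | c <- S] ++ [seq vec3 d 0 1 | d <- S] ++
   [seq vec3 0 a 1 | a <- S] ++
   [seq vec3 (p.1 * p.2) p.2 1 | p <- pairs] ++
   [seq vec3 p.1 p.2 1 | p <- pairs & ~~ is_ratio p] ++
   [seq vec3 p.1 (p.1 / p.2) 1 | p <- pairs & ~~ is_ratio p]).

Lemma mem_pairs p : p \in pairs -> [/\ p.1 \in S, p.2 \in S, p.1 != 0 & p.2 != 0].
Proof. by move=> /allpairsP[[c a] [cS aS ->]]; split; rewrite ?mem_S_neq0. Qed.

Lemma uniq_pairs : uniq pairs.
Proof. by apply: allpairs_uniq => // -[a b] [c d] _ _ [-> ->]. Qed.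

Lemma uniq_multiple_points : uniq multiple_points.
Proof.
pose nz j (v : V) := v 0 j != 0.
  pose P1 v := addn (addn (nz 0 v) (nz 1 v)) (nz 2%:R v) == 1%N.
apply: (@uniq_cat_pred V P1).
- rewrite /= !inE !negb_or /= andbT -!andbA; apply/and3P; split.
  + by apply/eqP => /vec3_inj[/eqP]; rewrite oner_eq0.
  + by apply/eqP => /vec3_inj[/eqP]; rewrite oner_eq0.
  + by apply/eqP => /vec3_inj[_ /eqP]; rewrite oner_eq0.
- apply: (@uniq_cat_pred V (fun v : V => ~~ nz 2%:R v)).
  + by rewrite map_inj_uniq // => c d /vec3_inj[].
  + apply: (@uniq_cat_pred V (fun v : V => ~~ nz 1 v)).
    * by rewrite map_inj_uniq // => c d /vec3_inj[].
    * apply: (@uniq_cat_pred V (fun v : V => ~~ nz 0 v)).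
      -- by rewrite map_inj_uniq // => c d /vec3_inj[].
      (* Off the triangle the three families are separated by whether y and x / y lie in [S]: both,
         only y, or only x / y. *)
      -- apply: (@uniq_cat_pred V (fun v : V => (v 0 1 \in S) && is_ratio (v 0 0, v 0 1))).
         ++ rewrite map_inj_in_uniq ?uniq_pairs // => -[c a] [c' a'].
            move=> /mem_pairs[_ _ _ /= a0] _ /vec3_inj[/= + e _]; rewrite -e.
            by move=> /(mulIf a0) ->.
         ++ apply: (@uniq_cat_pred V (fun v : V => v 0 1 \in S)).
            ** rewrite map_inj_uniq ?filter_uniq ?uniq_pairs //.
               by move=> [c a] [c' a'] /vec3_inj[/= -> ->].
            ** rewrite map_inj_in_uniq ?filter_uniq ?uniq_pairs //.
               move=> [d c] [d' c']; rewrite !mem_filter.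
               move=> /andP[r /mem_pairs[h1 h2 /= d0 c0]] h3 /vec3_inj[/= e1 e2 e3].
               by rewrite e1 in d0 e2 *; rewrite (invr_inj (mulfI d0 e2)).
            ** apply/allP => v /mapP[p]; rewrite mem_filter => /andP[_ /mem_pairs[_ h _ _]] ->.
               by rewrite mxE.
            ** apply/allP => v /mapP[[d c]]; rewrite mem_filter => /andP[r].
               by move=> /mem_pairs[_ _ _ c0] ->; rewrite /= mxE /= -is_ratioE.
         ++ apply/allP => _ /mapP[[c a] /mem_pairs[/= cS aS c0 a0] ->].
            by rewrite !mxE /= aS is_ratioE // mulfK.
         ++ rewrite all_cat; apply/andP; split; apply/allP => v /mapP[[d c]].
              rewrite mem_filter => /andP[r _] ->.
              by rewrite /= !mxE /= negb_and r orbT.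
            rewrite mem_filter => /andP[r /mem_pairs[_ _ _ /= c0]] ->.
            by rewrite /= !mxE /= negb_and -is_ratioE // r.
      -- by apply/allP => _ /mapP[c _ ->]; rewrite /nz mxE eqxx.
      -- rewrite !all_cat; apply/and3P; split; apply/allP => v /mapP[[c a]].
         ++ by move=> /mem_pairs[_ _ c0 a0] ->; rewrite /nz /= mxE /= mulf_eq0 negb_or c0 a0.
         ++ rewrite mem_filter => /andP[_ /mem_pairs[_ _ c0 a0]] ->.
            by rewrite /nz /= mxE /= c0.
         ++ rewrite mem_filter => /andP[_ /mem_pairs[_ _ c0 a0]] ->.
            by rewrite /nz /= mxE /= c0.
    * by apply/allP => _ /mapP[c _ ->]; rewrite /nz mxE eqxx.
    * rewrite !all_cat; apply/and4P; split; apply/allP => v /mapP[].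
      -- by move=> a aS ->; rewrite /nz /= mxE /= (mem_S_neq0 aS).
      -- by move=> [c a] /mem_pairs[_ _ c0 a0] ->; rewrite /nz /= mxE /= a0.
      -- move=> [c a]; rewrite mem_filter => /andP[_ /mem_pairs[_ _ c0 a0]] ->.
         by rewrite /nz /= mxE /= a0.
      -- move=> [c a]; rewrite mem_filter => /andP[_ /mem_pairs[_ _ c0 a0]] ->.
         by rewrite /nz /= mxE /= mulf_eq0 invr_eq0 negb_or c0 a0.
  + by apply/allP => _ /mapP[c _ ->]; rewrite /nz mxE eqxx.
  + rewrite !all_cat; do !(apply/andP; split); apply/allP => _ /mapP[p _ ->];
      by rewrite /nz /= mxE /= oner_eq0.
- by rewrite /= /P1 /nz !mxE /= !eqxx !oner_eq0.
- rewrite !all_cat; do !(apply/andP; split); apply/allP => v /mapP[].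
  + by move=> c cS ->; rewrite /P1 /nz /= !mxE /= (mem_S_neq0 cS) oner_eq0 eqxx.
  + by move=> c cS ->; rewrite /P1 /nz /= !mxE /= (mem_S_neq0 cS) oner_eq0 eqxx.
  + by move=> c cS ->; rewrite /P1 /nz /= !mxE /= (mem_S_neq0 cS) oner_eq0 eqxx.
  + move=> [c a] /mem_pairs[_ _ c0 a0] ->.
    by rewrite /P1 /nz /= !mxE /= mulf_eq0 (negPf c0) (negPf a0) oner_eq0.
  + move=> [c a]; rewrite mem_filter => /andP[_ /mem_pairs[_ _ c0 a0]] ->.
    by rewrite /P1 /nz /= !mxE /= (negPf c0) (negPf a0) oner_eq0.
  + move=> [c a]; rewrite mem_filter => /andP[_ /mem_pairs[_ _ c0 a0]] ->.
    by rewrite /P1 /nz /= !mxE /= mulf_eq0 invr_eq0 (negPf c0) (negPf a0) oner_eq0.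
Qed.

End Triangular.

Section TriangularCount.
Variable R : realType.
Local Notation C := R[i].
Local Notation V := 'rV[C]_3.
Variable S : seq C.
Hypothesis uS : uniq S.
Hypothesis S0 : 0 \notin S.
Hypothesis sizeS : size S = 4%N.

Let mem0 := mem_S_neq0 S0.

Lemma roots_count0l y : y != 0 -> roots_count S 0 y = 0%N.
Proof. by move=> y0; rewrite roots_countE // mul0r (negPf S0). Qed.

Lemma roots_count1 x : roots_count S x 1 = (x \in S).
Proof. by rewrite roots_countE ?oner_eq0 // divr1. Qed.

Lemma roots_count_zero x : x != 0 -> roots_count S x 0 = 0%N.
Proof. by move=> x0; rewrite roots_count0 (negPf x0). Qed.

Lemma multiple_points_lead v : v \in multiple_points S ->
  lead [:: 2%:R; 1; 0] v = 1.
Proof.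
rewrite !mem_cat !inE => /orP[/or3P[]/eqP ->|].
- by rewrite lead_vec3_bwd eqxx oner_eq0.
- by rewrite lead_vec3_bwd eqxx oner_eq0.
- by rewrite lead_vec3_bwd oner_eq0.
move=> /orP[|]; last do 4?[move=> /orP[|]]; move=> /mapP[c _ ->];
  by rewrite lead_vec3_bwd ?eqxx ?oner_eq0.
Qed.

Lemma multiple_points_complete v : lead [:: 2%:R; 1; 0] v = 1 ->
  (2 <= multiplicity (tri_lines S) v)%N -> v \in multiple_points S.
Proof.
rewrite (vec3E v); move: (v 0 0) (v 0 1) (v 0 2%:R) => x y z {v}.
rewrite lead_vec3_bwd multiplicity_tri !mem_cat.
have [->|z0] := eqVneq z 0; last first.
  move=> /= z1; subst z; rewrite !roots_count1.
  have [->|x0] := eqVneq x 0; have [->|y0] := eqVneq y 0.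
  - by rewrite !inE eqxx !orbT.
  - rewrite roots_count0l // (negPf S0) /=.
    case yS: (y \in S) => // _.
    by rewrite [X in [|| _, _, _, X | _]](map_f (fun a => vec3 0 a 1) yS) ?orbT.
  - rewrite roots_count_zero // (negPf S0) /=.
    case xS: (x \in S) => // _.
    by rewrite [X in [|| _, _, X | _]](map_f (fun a => vec3 a 0 1) xS) ?orbT.
  (* Off the triangle the multiplicity is the number of true statements among y in [S], x in [S], x
     / y in [S]; at least two hold. *)
  rewrite roots_countE // /=.
  case yS: (y \in S); case xS: (x \in S); case cS: (x / y \in S) => //= _.
  - have h : (x / y, y) \in pairs S by apply/allpairsP; exists (x / y, y).
    have := map_f (fun p : C * C => vec3 (p.1 * p.2) p.2 1) h.
    by rewrite /= mulfVK // => ->; rewrite ?orbT.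
  - have h : (x, y) \in [seq p <- pairs S | ~~ is_ratio S p].
      by rewrite mem_filter is_ratioE // cS; apply/allpairsP; exists (x, y).
    by rewrite [X in [|| _, _, _, _, _, X | _]](map_f (fun p : C * C => vec3 p.1 p.2 1) h) ?orbT.
  - have h : (x / y, y) \in pairs S by apply/allpairsP; exists (x / y, y).
    have := map_f (fun p : C * C => vec3 (p.1 * p.2) p.2 1) h.
    by rewrite /= mulfVK // => ->; rewrite ?orbT.
  - have xy0 : x / y != 0 by rewrite mulf_neq0 ?invr_eq0.
    have yE : x / (x / y) = y by rewrite invf_div mulrC mulfVK.
    have h : (x, x / y) \in [seq p <- pairs S | ~~ is_ratio S p].
      rewrite mem_filter is_ratioE // yE yS /=.
      by apply/allpairsP; exists (x, x / y).
    have := map_f (fun p : C * C => vec3 p.1 (p.1 / p.2) 1) h.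
    by rewrite /= yE => ->; rewrite ?orbT.
have [->|y0] := eqVneq y 0.
  by case: eqVneq => [-> /esym/eqP|x0 /= ->]; rewrite ?oner_eq0 // !inE eqxx.
move=> /= y1; subst y; rewrite roots_count1 !roots_count0.
have [->|x0] := eqVneq x 0; first by rewrite !inE eqxx !orbT.
rewrite ?oner_eq0 ?mul0n; case xS: (x \in S) => // _.
by rewrite [X in [|| _, X | _]](map_f (fun a => vec3 a 1 0) xS) ?orbT.
Qed.

(** This and the next number both count the triples d = c a in [S], by (c, a) here and by (d, a)
    there, matching the two ways in which points are listed. *)
Definition products_in : nat := count (fun p => p.1 * p.2 \in S) (pairs S).
Definition ratios_in : nat := count (is_ratio S) (pairs S).

Lemma count_const (T : eqType) (s : seq T) (f : T -> nat) m i :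
  {in s, forall x, f x = m} -> count (fun x => f x == i) s = muln (m == i) (size s).
Proof.
elim: s => [|x s IH] h; first by rewrite muln0.
rewrite /= h ?mem_head // IH ?mulnS // => y ys.
by apply: h; rewrite inE ys orbT.
Qed.

Lemma count_two_values (T : eqType) (s : seq T) (f : T -> nat) (P : pred T) m i :
  {in s, forall x, f x = addn m (P x)} -> count (fun x => f x == i) s =
  addn (muln (m.+1 == i) (count P s)) (muln (m == i) (size s - count P s)).
Proof.
elim: s => [|x s IH] h; first by rewrite !muln0.
have cs : (count P s <= size s)%N by apply: count_size.
rewrite /= h ?mem_head // IH => [|y ys]; last by apply: h; rewrite inE ys orbT.
case: (P x); rewrite ?addn1 ?addn0 ?add1n ?add0n.
  by rewrite subSS mulnS addnA.
by rewrite subSn // mulnS addnCA.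
Qed.

(** A vertex lies on two sides and the four lines of its pencil. With 12 products and 12 ratios the
    formula gives t_6 = 3, t_3 = 12, t_2 = 24. *)
Lemma t_tri i : (2 <= i)%N -> t_ (arrangement (tri_lines S)) i =
  addn (muln (6 == i) 3) (addn (muln (2 == i) 12)
    (addn (addn (muln (3 == i) products_in) (muln (2 == i) (16 - products_in)))
          (muln (2 == i) (2 * (16 - ratios_in))))).
Proof.
move=> i2; have sp : size (pairs S) = 16%N by rewrite size_allpairs sizeS.
rewrite (@t_count _ [:: 2%:R; 1; 0] _ (multiple_points S)
  _ (tri_line_family uS S0)) //; first last.
- by move=> v; apply: multiple_points_complete.
- exact: multiple_points_lead.
- exact: uniq_multiple_points.
- by elim/ord3_ind; rewrite !inE eqxx ?orbT.
pose mt x y z := multiplicity (tri_lines S) (vec3 x y z).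
have m6 : {in [:: vec3 1 0 0; vec3 0 1 0; vec3 0 0 1],
    forall v, multiplicity (tri_lines S) v = 6}.
  move=> v; rewrite !inE => /or3P[] /eqP ->; rewrite multiplicity_tri.
  - by rewrite !roots_count0 !eqxx oner_eq0 sizeS.
  - by rewrite !roots_count0 roots_count0l ?oner_eq0 // !eqxx sizeS.
  - by rewrite roots_count0 !roots_count0l ?oner_eq0 // !eqxx sizeS.
have mC : {in S, forall c, mt c 1 0 = 2}.
  move=> c cS; rewrite /mt multiplicity_tri roots_count1 cS !roots_count0.
  by rewrite (negPf (mem0 cS)) oner_eq0 eqxx.
have mD : {in S, forall c, mt c 0 1 = 2}.
  move=> c cS; rewrite /mt multiplicity_tri !roots_count1 cS roots_count0.
  by rewrite (negPf S0) (negPf (mem0 cS)) oner_eq0 eqxx.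
have mA : {in S, forall c, mt 0 c 1 = 2}.
  move=> c cS; rewrite /mt multiplicity_tri !roots_count1 cS roots_count0l ?mem0 //.
  by rewrite (negPf S0) (negPf (mem0 cS)) oner_eq0 eqxx.
have mP : {in pairs S, forall p, mt (p.1 * p.2) p.2 1 = addn 2 (p.1 * p.2 \in S)}.
  move=> [c a] /(mem_pairs S0)[/= cS aS c0 a0]; rewrite /mt multiplicity_tri.
  rewrite !roots_count1 aS roots_countE // mulfK // cS.
  by rewrite mulf_eq0 (negPf c0) (negPf a0) oner_eq0.
have mR : {in [seq p <- pairs S | ~~ is_ratio S p], forall p, mt p.1 p.2 1 = 2}.
  move=> [d a]; rewrite mem_filter => /andP[r /(mem_pairs S0)[/= dS aS d0 a0]].
  rewrite /mt multiplicity_tri !roots_count1 aS dS roots_countE // -is_ratioE //.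
  by rewrite (negPf r) (negPf d0) (negPf a0) oner_eq0.
have mQ : {in [seq p <- pairs S | ~~ is_ratio S p], forall p, mt p.1 (p.1 / p.2) 1 = 2}.
  move=> [d c]; rewrite mem_filter => /andP[r /(mem_pairs S0)[/= dS cS d0 c0]].
  have dc0 : d / c != 0 by rewrite mulf_neq0 ?invr_eq0.
  rewrite /mt multiplicity_tri !roots_count1 dS roots_countE //.
  rewrite -(is_ratioE uS d c0) (negPf r).
  have -> : d / (d / c) = c by rewrite invf_div mulrC mulfVK.
  rewrite cS.
  by rewrite (negPf d0) (negPf dc0) oner_eq0.
have sR : size [seq p <- pairs S | ~~ is_ratio S p] = (16 - ratios_in)%N.
  by rewrite size_filter -sp -(count_predC (is_ratio S)) addKn.
rewrite /multiple_points !count_cat !count_map (count_const i m6).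
rewrite (count_const i mC) (count_const i mD) (count_const i mA) (count_two_values i mP).
rewrite (count_const i mR) (count_const i mQ) sizeS sR sp -/products_in.
by rewrite /=; move: (2 == i) (3 == i) (6 == i) => b2 b3 b6; lia.
Qed.

End TriangularCount.

Lemma tri_same_weak_combinatorics (R : realType) (S S' : seq R[i]) :
  uniq S -> 0 \notin S -> size S = 4%N -> uniq S' -> 0 \notin S' -> size S' = 4%N ->
  products_in S = products_in S' -> ratios_in S = ratios_in S' ->
  same_weak_combinatorics (arrangement (tri_lines S)) (arrangement (tri_lines S')).
Proof.
move=> uS S0 sS uS' S0' sS' ep er; split=> [|i /andP[i2 _]].
  rewrite (card_arrangement (tri_line_family uS S0)).
  rewrite (card_arrangement (tri_line_family uS' S0')).
  by rewrite /tri_lines !size_cat !size_map sS sS'.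
by rewrite (t_tri uS S0 sS i2) (t_tri uS' S0' sS' i2) ep er.
Qed.

(** * Syzygies from fields with prescribed cofactors *)

Section TriangularSyzygies.
Variable R : realType.
Local Notation C := R[i].
Local Notation V := 'rV[C]_3.
Variables (S : seq C) (s : V -> V).
Variables (kx ky kz : V -> C) (kC kA kD : C -> V -> C).

Definition tri_trace (v : V) : C :=
  kx v + ky v + kz v +
  (\sum_(c <- S) kC c v + (\sum_(a <- S) kA a v + \sum_(d <- S) kD d v)).

Definition tri_field (v : V) : V :=
  (size (tri_lines S))%:R *: s v - tri_trace v *: v.

Lemma tri_syzygy v :
  s v 0 0 = v 0 0 * kx v -> s v 0 1 = v 0 1 * ky v ->
  s v 0 2%:R = v 0 2%:R * kz v ->
  {in S, forall c, s v 0 0 - c * s v 0 1 = (v 0 0 - c * v 0 1) * kC c v} ->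
  {in S, forall a, s v 0 1 - a * s v 0 2%:R = (v 0 1 - a * v 0 2%:R) * kA a v} ->
  {in S, forall d, s v 0 0 - d * s v 0 2%:R = (v 0 0 - d * v 0 2%:R) * kD d v} ->
  dir_deriv (lines_poly (tri_lines S)) (tri_field v) v = 0.
Proof.
move=> hx hy hz hC hA hD.
pose lk (v : V) : seq (V * C) :=
  [:: (vec3 1 0 0, kx v); (vec3 0 1 0, ky v); (vec3 0 0 1, kz v)] ++
  [seq (vec3 1 (- c) 0, kC c v) | c <- S] ++
  [seq (vec3 0 1 (- a), kA a v) | a <- S] ++
  [seq (vec3 1 0 (- d), kD d v) | d <- S].
have elk : unzip1 (lk v) = tri_lines S.
  by rewrite /unzip1 /lk !map_cat -!map_comp.
have -> : tri_field v =
    (size (tri_lines S))%:R *: s v - (\sum_(p <- lk v) p.2) *: v.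
  rewrite /tri_field /tri_trace /lk !big_cat !big_map /= !big_cons big_nil /=.
  by rewrite addr0 !addrA.
apply: euler_correction elk _ => p.
rewrite !mem_cat !inE => /or4P[/or3P[]/eqP ->|||].
- by rewrite !dotE !mxE /= !(mul1r, mul0r, addr0).
- by rewrite !dotE !mxE /= !(mul1r, mul0r, addr0, add0r).
- by rewrite !dotE !mxE /= !(mul1r, mul0r, add0r).
- by move=> /mapP[c cS ->]; rewrite !dotE !mxE /= !(mul1r, mul0r, addr0, mulNr) hC.
- by move=> /mapP[c cS ->]; rewrite !dotE !mxE /= !(mul1r, mul0r, add0r, mulNr) hA.
- by move=> /mapP[c cS ->]; rewrite !dotE !mxE /= !(mul1r, mul0r, addr0, mulNr) hD.
Qed.

Lemma form_tri_field m : (forall j, form_fun m.+1 (fun v => s v 0 j)) ->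
  form_fun m kx -> form_fun m ky -> form_fun m kz ->
  (forall c, form_fun m (kC c)) -> (forall c, form_fun m (kA c)) ->
  (forall c, form_fun m (kD c)) ->
  forall j, form_fun m.+1 (fun v => tri_field v 0 j).
Proof.
move=> hs hx hy hz hC hA hD j; rewrite /tri_field; under eq_fun do rewrite !mxE.
apply: form_sub; first exact: form_scale.
rewrite -addn1; apply: form_mul; last exact: form_coord.
by repeat apply: form_add => //; apply: form_sum => c _.
Qed.

Lemma line_prod_tri v : line_prod (tri_lines S) v =
  v 0 0 * (v 0 1 * v 0 2%:R) *
  (\prod_(c <- S) (v 0 0 - c * v 0 1) * (\prod_(a <- S) (v 0 1 - a * v 0 2%:R) *
   \prod_(d <- S) (v 0 0 - d * v 0 2%:R))).
Proof.
rewrite /line_prod /tri_lines !big_cat !big_map /= !big_cons big_nil.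
rewrite !dotE !mxE /= !(mul1r, mul0r, add0r, addr0, mulr1).
by congr (_ * (_ * (_ * _))); apply: eq_bigr => c _;
  rewrite dotE !mxE /= !(mul1r, mul0r, add0r, addr0) mulNr.
Qed.

End TriangularSyzygies.

(** Moves the count from complex numbers to indices (integers, or exponents modulo 5), where [B] can
    be evaluated. *)
Lemma triples_count (R : realType) (T : Type) (f : T -> R[i]) (s : seq T)
    (B : T -> T -> T -> bool) :
  (forall i j k, (f i * f j == f k) = B i j k) ->
  products_in (map f s) =
    count (fun p => has (B p.1 p.2) s) [seq (i, j) | i <- s, j <- s] /\
  ratios_in (map f s) =
    count (fun p => has (fun k => B k p.2 p.1) s) [seq (i, j) | i <- s, j <- s].
Proof.
move=> hB; have ep : pairs (map f s) =
    [seq (f p.1, f p.2) | p <- [seq (i, j) | i <- s, j <- s]].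
  by rewrite /pairs allpairs_mapl allpairs_mapr map_allpairs.
rewrite /products_in /ratios_in ep !count_map; split; apply: eq_count => -[i j] /=.
  have -> : (f i * f j \in map f s) = has (fun k => f i * f j == f k) s.
    by elim: s {ep} => //= k s <-; rewrite inE.
  by apply: eq_has => k; apply: hB.
by rewrite /is_ratio has_map; apply: eq_has => k /=; rewrite eq_sym hB.
Qed.

(** * The two arrangements *)

Lemma form_degree (R : realType) m n (F : 'rV[R[i]]_3 -> R[i]) :
  form_fun m F -> m = n -> form_fun n F.
Proof. by move=> hF <-. Qed.

(** Degrees are synthesized from the shape of the expression; two summands may get different
    arithmetic expressions, which are matched by computation through [form_degree]. *)
Ltac form_infer :=
  lazymatch goal with
  | |- form_fun _ (fun v => @?F v + @?G v) =>
      eapply form_add; [form_infer | eapply form_degree; [form_infer | reflexivity]]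
  | |- form_fun _ (fun v => - @?F v) => eapply form_opp; form_infer
  | |- form_fun _ (fun v => @?F v * @?G v) => eapply form_mul; form_infer
  | |- form_fun _ (fun v => @?F v ^+ ?n) => eapply form_exp; form_infer
  | |- _ => first [eapply form_coord | eapply form_const]
  end.

Ltac form_solve := eapply form_degree; [form_infer | reflexivity].

Section FreeExample.
Variable R : realType.
Local Notation C := R[i].
Local Notation V := 'rV[C]_3.

Definition free_roots : seq C := [seq k%:~R | k <- [:: 1; -1; 2; -2]].

Lemma free_roots_uniq : uniq free_roots.
Proof. by rewrite map_inj_uniq //; exact: intr_inj. Qed.

Lemma free_roots_neq0 : 0 \notin free_roots.
Proof. by rewrite /free_roots -[0]/(0%:~R) mem_map //; exact: intr_inj. Qed.

Lemma free_roots_counts : products_in free_roots = 12 /\ ratios_in free_roots = 12.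
Proof.
have [|-> ->] := @triples_count R int intr [:: 1; -1; 2; -2] (fun i j k => i * j == k).
  by move=> i j k; rewrite -intrM; apply: (inj_eq intr_inj).
by [].
Qed.

Lemma prod_free_roots s t : \prod_(c <- free_roots) (s - c * t) =
  (s ^+ 2 - t ^+ 2) * (s ^+ 2 - 4 * t ^+ 2).
Proof. by rewrite !big_cons big_nil; ring. Qed.

(* The quotient of [(s^2 - t^2)(s^2 - 4 t^2)] by [s - c t], for a root [c]. *)
Definition cofactor (c s t : C) : C :=
  s ^+ 3 + c * s ^+ 2 * t + (c ^+ 2 - 5) * s * t ^+ 2 + c * (c ^+ 2 - 5) * t ^+ 3.

Lemma cofactorE c s t : c \in free_roots -> (s - c * t) * cofactor c s t =
  (s ^+ 2 - t ^+ 2) * (s ^+ 2 - 4 * t ^+ 2).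
Proof.
by rewrite /cofactor !inE => /or4P[]/eqP ->; ring.
Qed.

Definition quartic (i j : 'I_3) (v : V) : C :=
  (v 0 i ^+ 2 - v 0 j ^+ 2) * (v 0 i ^+ 2 - 4 * v 0 j ^+ 2).

(* [rel] is a linear syzygy, in the squares of the coordinates, among the
   quartics of the three pencils of lines. *)
Section Syzygy.
Variables (w u p : V -> C).
Hypothesis form_w : form_fun 2 w.
Hypothesis form_u : form_fun 2 u.
Hypothesis form_p : form_fun 2 p.
Hypothesis rel : forall v, w v * quartic 0 1 v + u v * quartic 1 2%:R v =
  p v * quartic 0 2%:R v.

(** The zero middle coordinate is a normalization modulo the Euler field; tangency to x = 0, z = 0
    and two pencils then dictates the other two. For x = d z, the difference of the outer
    coordinates is x - d z times the first quotient, plus d z times the left side of [rel], and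
    [rel] makes the latter divisible. *)
Definition syzygy_field (v : V) : V :=
  vec3 (v 0 0 * (w v * quartic 0 1 v)) 0
       (- (v 0 2%:R * (u v * quartic 1 2%:R v))).

Definition free_field : V -> V := tri_field free_roots syzygy_field
  (fun v => w v * quartic 0 1 v) (fun=> 0) (fun v => - (u v * quartic 1 2%:R v))
  (fun c v => v 0 0 * (w v * cofactor c (v 0 0) (v 0 1)))
  (fun a v => a * v 0 2%:R * (u v * cofactor a (v 0 1) (v 0 2%:R)))
  (fun d v => w v * quartic 0 1 v +
              d * v 0 2%:R * (p v * cofactor d (v 0 0) (v 0 2%:R))).

Lemma free_field_syzygy v :
  dir_deriv (lines_poly (tri_lines free_roots)) (free_field v) v = 0.
Proof.
apply: tri_syzygy => [||| c cS | a aS | d dS]; rewrite /syzygy_field !mxE /=.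
- by [].
- by rewrite mulr0.
- by rewrite mulrN.
- by rewrite mulr0 subr0 /quartic -(cofactorE _ _ cS); ring.
- by rewrite /quartic -(cofactorE _ _ aS); ring.
- have e : (v 0 0 - d * v 0 2%:R) * cofactor d (v 0 0) (v 0 2%:R) = quartic 0 2%:R v.
    exact: cofactorE.
  have := rel v; rewrite -e.
  move: (w v * _) (u v * _) (cofactor _ _ _) => A B c h.
  rewrite mulrDr -[in RHS](mulrA d) [in RHS]mulrCA [X in _ = _ + d * X]mulrCA.
  rewrite [X in _ = _ + d * (_ * X)]mulrCA -h; ring.
Qed.

Lemma form_free_field j : form_fun 7 (fun v => free_field v 0 j).
Proof.
have fq i k : form_fun 4 (quartic i k) by rewrite /quartic; form_solve.
have fc (c : C) i k : form_fun 3 (fun v => cofactor c (v 0 i) (v 0 k)).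
  by rewrite /cofactor; form_solve.
have fwq : form_fun 6 (fun v => w v * quartic 0 1 v).
  exact: (form_mul form_w (fq 0 1)).
have fuq : form_fun 6 (fun v => u v * quartic 1 2%:R v).
  exact: (form_mul form_u (fq 1 2%:R)).
have fcoord (c : C) i : form_fun 1 (fun v : V => c * v 0 i).
  by apply: form_scale; apply: form_coord.
apply: form_tri_field => [i||||c|a|d].
- rewrite /syzygy_field; under eq_fun do rewrite mxE.
  elim/ord3_ind: i => /=.
  + exact: (form_mul (form_coord R 0) fwq).
  + exact: form_zero.
  + by apply: form_opp; exact: (form_mul (form_coord R 2%:R) fuq).
- by [].
- exact: form_zero.
- exact: form_opp.
- exact: (form_mul (form_coord R 0) (form_mul form_w (fc c 0 1))).
- exact: (form_mul (fcoord a 2%:R) (form_mul form_u (fc a 1 2%:R))).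
- apply: form_add => //.
  exact: (form_mul (fcoord d 2%:R) (form_mul form_p (fc d 0 2%:R))).
Qed.

End Syzygy.

(** In the squares of the coordinates the three quartics span the conics through (1:1:1), (4:1:1)
    and (4:4:1). The ideal of three noncollinear points has, by Hilbert-Burch, two independent
    linear syzygies; [field1] and [field2] use a basis of them. *)
Definition field1 : V -> V := free_field
  (fun v => v 0 1 ^+ 2 - 4 * v 0 2%:R ^+ 2)
  (fun v => 5 * v 0 0 ^+ 2 - 4 * v 0 1 ^+ 2 - 4 * v 0 2%:R ^+ 2)
  (fun v => v 0 1 ^+ 2 - 4 * v 0 2%:R ^+ 2).

Definition field2 : V -> V := free_field
  (fun v => v 0 0 ^+ 2 + v 0 1 ^+ 2 - 5 * v 0 2%:R ^+ 2)
  (fun v => v 0 0 ^+ 2 - 4 * v 0 1 ^+ 2)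
  (fun v => v 0 0 ^+ 2 - 4 * v 0 1 ^+ 2).

(** The constant is 15^2 times -5: the square comes from the Euler corrections, and -5 from the
    minor of the two syzygies in [w] and [u], which is -5 times the third quartic. *)
Lemma det3_fields v : det3 v (field1 v) (field2 v) =
  - 1125 * line_prod (tri_lines free_roots) v.
Proof.
rewrite /field1 /field2 /free_field /tri_field det3_euler line_prod_tri !prod_free_roots.
have -> : size (tri_lines free_roots) = 15%N by [].
rewrite /det3 /syzygy_field !mxE /= /quartic.
by move: (v 0 0) (v 0 1) (v 0 2%:R) => x y z; ring.
Qed.

Lemma free_example : free_arrangement (arrangement (tri_lines free_roots)).
Proof.
have hL := tri_line_family free_roots_uniq free_roots_neq0.
exists (lines_poly (tri_lines free_roots)); first exact: arrangement_equation.
exists 7%:Z, 7%:Z.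
apply: (@free_criterion R _ 7 7 field1 field2 (- 1125)) => //.
- by move=> j; apply: form_free_field; form_solve.
- by move=> j; apply: form_free_field; form_solve.
- move=> v; apply: free_field_syzygy => x; rewrite /quartic.
  by move: (x 0 0) (x 0 1) (x 0 2%:R) => {v x} x y z; ring.
- move=> v; apply: free_field_syzygy => x; rewrite /quartic.
  by move: (x 0 0) (x 0 1) (x 0 2%:R) => {v x} x y z; ring.
- by rewrite oppr_eq0 pnatr_eq0.
- exact: det3_fields.
Qed.

End FreeExample.

Section NonfreeExample.
Variable R : realType.
Local Notation C := R[i].
Local Notation V := 'rV[C]_3.

(** A root of 1 + X + X^2 + X^3 + X^4 has order dividing the prime 5, and the order is not 1 because
    the value at 1 is 5. *)
Lemma exists_primitive_5root : exists z : C, 5.-primitive_root z.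
Proof.
pose q : {poly C} := \sum_(i < 5) 'X^i.
have sq : size q != 1%N.
  have -> : q = \poly_(i < 5) 1 by rewrite poly_def; apply: eq_bigr => i _; rewrite scale1r.
  by rewrite size_poly_eq // oner_eq0.
have /closed_rootP[z rz] := sq; exists z.
have qz : \sum_(i < 5) z ^+ i = 0.
  have := rz; rewrite /root /q horner_sum.
  by under eq_bigr do rewrite hornerXn; move/eqP.
have z5 : z ^+ 5 = 1.
  by apply/eqP; rewrite -subr_eq0 subrX1 qz mulr0.
have [m pm m5] := prim_order_exists (isT : (0 < 5)%N) z5.
have [|m1] := eqVneq m 5%N; first by move=> <-.
have {m1 m5} m1 : m = 1%N.
  have /primeP[_ /(_ m m5)] : prime 5 by [].
  by rewrite (negPf m1) orbF => /eqP.
move: (prim_expr_order pm); rewrite m1 expr1 => z1.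
move/eqP: qz; rewrite z1; under eq_bigr do rewrite expr1n.
by rewrite sumr_const card_ord pnatr_eq0.
Qed.

Variable z : C.
Hypothesis prim_z : 5.-primitive_root z.

Definition fifth_roots : seq C := [seq z ^+ k | k <- iota 1 4].

Lemma fifth_roots_uniq : uniq fifth_roots.
Proof.
rewrite map_inj_in_uniq ?iota_uniq // => i j; rewrite !mem_iota => hi hj /eqP.
by rewrite (eq_prim_root_expr prim_z) !modn_small; [move/eqP|lia|lia].
Qed.

Lemma z_neq0 : z != 0.
Proof.
apply/eqP => z0; have := prim_expr_order prim_z.
by rewrite z0 expr0n /= => /esym/eqP; rewrite oner_eq0.
Qed.

Lemma fifth_roots_neq0 : 0 \notin fifth_roots.
Proof.
apply/mapP => -[k _ /esym/eqP]; rewrite expf_eq0 => /andP[_].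
by rewrite (negPf z_neq0).
Qed.

Lemma fifth_rootsE c : c \in fifth_roots -> c ^+ 5 = 1 /\ c != 1.
Proof.
move=> /mapP[k]; rewrite mem_iota => hk ->; split.
  by rewrite -exprM mulnC exprM (prim_expr_order prim_z) expr1n.
rewrite -(expr0 z) (eq_prim_root_expr prim_z) mod0n modn_small; lia.
Qed.

Lemma fifth_roots_counts : products_in fifth_roots = 12 /\ ratios_in fifth_roots = 12.
Proof.
have [|-> ->] := @triples_count R nat (fun k => z ^+ k) (iota 1 4)
    (fun i j k => i + j == k %[mod 5])%N.
  by move=> i j k; rewrite -exprD (eq_prim_root_expr prim_z).
by [].
Qed.

(** The quotient of s^6 - (c t)^6 by s - c t. The exponent 6 is chosen because c^6 = c. *)
Definition power_sum (c s t : C) : C := \sum_(i < 6) s ^+ (5 - i) * (c * t) ^+ i.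

Lemma power_sumE c s t : c \in fifth_roots ->
  s ^+ 6 - c * t ^+ 6 = (s - c * t) * power_sum c s t.
Proof.
move=> /fifth_rootsE[c5 _].
have -> : (s - c * t) * power_sum c s t = s ^+ 6 - (c * t) ^+ 6 by exact/esym/subrXX.
by rewrite exprMn [c ^+ 6]exprS c5 mulr1.
Qed.

(** The uncorrected field is a basic derivation of the reflection arrangement of 18 lines obtained
    by also admitting the root 1. The three lines omitted here, x = y, y = z and x = z, meet at (1 :
    1 : 1), where the corrected field vanishes. *)
Definition fermat_field : V -> V := tri_field fifth_roots
  (fun v => vec3 (v 0 0 ^+ 6) (v 0 1 ^+ 6) (v 0 2%:R ^+ 6))
  (fun v => v 0 0 ^+ 5) (fun v => v 0 1 ^+ 5) (fun v => v 0 2%:R ^+ 5)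
  (fun c v => power_sum c (v 0 0) (v 0 1))
  (fun a v => power_sum a (v 0 1) (v 0 2%:R))
  (fun d v => power_sum d (v 0 0) (v 0 2%:R)).

Lemma fermat_field_syzygy v : dir_deriv (lines_poly (tri_lines fifth_roots)) (fermat_field v) v = 0.
Proof.
apply: tri_syzygy => [||| c cS | a aS | d dS]; rewrite !mxE /= -?exprS //;
  exact: power_sumE.
Qed.

Lemma form_fermat_field j : form_fun 6 (fun v => fermat_field v 0 j).
Proof.
have fs (c : C) i k : form_fun 5 (fun v : V => power_sum c (v 0 i) (v 0 k)).
  rewrite /power_sum; apply: form_sum => n _.
  apply: (form_degree (m := (1 * (5 - n) + 1 * n)%N)); last by have := ltn_ord n; lia.
  apply: form_mul; first by apply: form_exp; apply: form_coord.
  by apply: form_exp; apply: form_scale; apply: form_coord.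
apply: form_tri_field => [i||||||]; rewrite //.
- by under eq_fun do rewrite mxE; elim/ord3_ind: i => /=; form_solve.
- by form_solve.
- by form_solve.
- by form_solve.
Qed.

(** Cancelling 1 - c is where the absence of the root 1 matters; for c = 1 the value would be 6. *)
Lemma power_sum11 c : c \in fifth_roots -> power_sum c 1 1 = 1.
Proof.
move=> cS; have := power_sumE 1 1 cS; rewrite expr1n mulr1 => /esym.
rewrite -[X in _ = X -> _]mulr1; have [_ c1] := fifth_rootsE cS.
by apply: mulfI; rewrite subr_eq0 eq_sym.
Qed.

Lemma size_tri_fifth : size (tri_lines fifth_roots) = 15%N.
Proof. by []. Qed.

Lemma sum_fifth_const (F : C -> C) x : {in fifth_roots, forall c, F c = x} ->
  \sum_(c <- fifth_roots) F c = 4 * x.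
Proof.
move=> hF; rewrite (eq_big_seq (fun=> x)) //.
by rewrite /fifth_roots big_map /= !big_cons big_nil; ring.
Qed.

Lemma fermat_field_p : fermat_field (vec3 1 1 1) = 0.
Proof.
rewrite /fermat_field /tri_field /tri_trace size_tri_fifth !mxE /= !expr1n.
have h : {in fifth_roots, forall c, power_sum c 1 1 = 1} by move=> c; apply: power_sum11.
rewrite !(sum_fifth_const h).
(* Each of the 15 lines contributes 1 to the trace, so the Euler correction cancels the field
   exactly. *)
have -> : 1 + 1 + 1 + (4 * 1 + (4 * 1 + 4 * 1)) = 15%:R :> C by ring.
by rewrite subrr.
Qed.

Lemma line_prod_p : line_prod (tri_lines fifth_roots) (vec3 1 1 1) != 0.
Proof.
rewrite line_prod_tri !mxE /= !mulr1 mul1r.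
have h : \prod_(c <- fifth_roots) (1 - c * 1) != 0.
  rewrite prodf_seq_neq0; apply/allP => c /fifth_rootsE[_ c1] /=.
  by rewrite mulr1 subr_eq0 eq_sym.
by rewrite !mulf_neq0.
Qed.

Lemma power_sum0l c t : c \in fifth_roots -> power_sum c 0 t = t ^+ 5.
Proof.
move=> /fifth_rootsE[c5 _]; rewrite /power_sum big_ord_recr /= mul1r big1 ?add0r => [|i _].
  by rewrite exprMn c5 mul1r.
by rewrite expr0n subn_eq0 leqNgt ltn_ord mul0r.
Qed.

Lemma power_sum0r c s : power_sum c s 0 = s ^+ 5.
Proof.
rewrite /power_sum mulr0 big_ord_recl /= expr0 mulr1 big1 ?addr0 // => i _.
by rewrite /= expr0n mulr0.
Qed.

Lemma sum_power_sum0l t : \sum_(c <- fifth_roots) power_sum c 0 t = 4 * t ^+ 5.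
Proof. by apply: sum_fifth_const => c; apply: power_sum0l. Qed.

Lemma sum_power_sum0r s : \sum_(c <- fifth_roots) power_sum c s 0 = 4 * s ^+ 5.
Proof. by apply: sum_fifth_const => c _; apply: power_sum0r. Qed.

(* On [z = 0] the first two coordinates of [fermat_field] are [x (15 x^5 - T)] and
   [y (15 y^5 - T)], [T] being the trace.  If they vanish with [x y != 0], then
   [x^5 = y^5 = h], every [power_sum c x y] is [h] or [6 h], and
   [15 h = T = (14 + 5 m) h] for a natural number [m]. *)
Lemma fermat_field_neq0 x y : vec3 x y 0 != 0 -> fermat_field (vec3 x y 0) != 0.
Proof.
move=> v0; apply/eqP => field0.
pose G := \sum_(c <- fifth_roots) power_sum c x y.
pose T := 5 * x ^+ 5 + 5 * y ^+ 5 + G.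
have trace : fermat_field (vec3 x y 0) =
    15 *: vec3 (x ^+ 6) (y ^+ 6) 0 - T *: vec3 x y 0.
  rewrite /fermat_field /tri_field /tri_trace size_tri_fifth !mxE /=.
  have -> : (0 : C) ^+ 6 = 0 by rewrite expr0n.
  congr (_ - _ *: _).
  by rewrite !sum_power_sum0r expr0n /= /T /G; ring.
have ex : x * (15 * x ^+ 5 - T) = 0.
  have := congr1 (fun v : V => v 0 0) field0; rewrite trace !mxE /= => <-; ring.
have ey : y * (15 * y ^+ 5 - T) = 0.
  have := congr1 (fun v : V => v 0 1) field0; rewrite trace !mxE /= => <-; ring.
have nat0 (n : nat) (t : C) : n.+1%:R * t ^+ 5 = 0 -> t = 0.
  by move=> /eqP; rewrite mulf_eq0 pnatr_eq0 /= expf_eq0 => /eqP.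
have [x0|x0] := eqVneq x 0; last have [y0|y0] := eqVneq y 0.
- have y0 : y != 0 by apply: contra_neq v0 => ->; rewrite x0; apply/rowP;
    elim/ord3_ind; rewrite !mxE.
  case/eqP: (y0); apply: (nat0 5%N); move/eqP: ey; rewrite mulf_eq0 (negPf y0) /= => /eqP <-.
  by rewrite /T /G x0 sum_power_sum0l expr0n /=; ring.
- case/eqP: (x0); apply: (nat0 5%N); move/eqP: ex; rewrite mulf_eq0 (negPf x0) /= => /eqP <-.
  by rewrite /T /G y0 sum_power_sum0r expr0n /=; ring.
move/eqP: ex; rewrite mulf_eq0 (negPf x0) /= subr_eq0 => /eqP ex.
move/eqP: ey; rewrite mulf_eq0 (negPf y0) /= subr_eq0 -ex => /eqP/esym ey.
have n15 : (15 : C) != 0 by rewrite pnatr_eq0.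
have {ey} ey : y ^+ 5 = x ^+ 5 by apply: (mulfI n15).
set h := x ^+ 5 in ex ey.
have k c : c \in fifth_roots -> exists m : nat, power_sum c x y = (1 + 5 * m)%:R * h.
  move=> cS; have [e|ne] := eqVneq x (c * y).
    exists 1%N; rewrite /power_sum -e !big_ord_recr big_ord0 /= /h; ring.
  exists 0%N; rewrite mul1r; have ne0 : x - c * y != 0 by rewrite subr_eq0.
  apply: (mulfI ne0); rewrite -power_sumE // [x ^+ 6]exprS [y ^+ 6]exprS ey -/h.
  ring.
have [m em] : exists m : nat, G = (4 + 5 * m)%:R * h.
  rewrite /G; have -> : 4%N = size fifth_roots by [].
  have : {subset fifth_roots <= fifth_roots} by [].
  elim: {1 3 4}fifth_roots => [|c s IH] sub.
    by exists 0%N; rewrite big_nil mul0r.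
  have [|m em] := IH; first by move=> d ds; apply: sub; rewrite inE ds orbT.
  have [n en] := k c (sub c (mem_head _ _)).
  exists (n + m)%N; rewrite big_cons em en -mulrDl -natrD; congr (_%:R * _).
  by rewrite /=; lia.
have eG : G = 5 * h.
  have -> : G = T - 10 * h by rewrite /T ey -/h; ring.
  by rewrite -ex; ring.
have h0 : h != 0 by rewrite expf_neq0.
have : (4 + 5 * m)%:R = 5%:R :> C by apply: (mulIf h0); rewrite -em eG.
by move=> /eqP; rewrite eqr_nat; lia.
Qed.

Lemma nonfree_example : ~ free_arrangement (arrangement (tri_lines fifth_roots)).
Proof.
have hL := tri_line_family fifth_roots_uniq fifth_roots_neq0.
apply: (arrangement_not_free hL).
apply: (nonfree_criterion (r := 6) hL _ form_fermat_field fermat_field_syzygy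
  line_prod_p fermat_field_p (u := vec3 1 0 0) (w := vec3 0 1 0)) => //.
- have e x y : x *: vec3 1 0 0 + y *: vec3 0 1 0 = vec3 x y 0 :> V.
    by apply/rowP; elim/ord3_ind; rewrite !mxE /= !(mulr0, mulr1, addr0, add0r).
  move=> x y; rewrite e => v0.
  by split; [have := congr1 (fun v : V => v 0 0) v0|have := congr1 (fun v : V => v 0 1) v0];
    rewrite !mxE.
- move=> x y; have -> : x *: vec3 1 0 0 + y *: vec3 0 1 0 = vec3 x y 0 :> V.
    by apply/rowP; elim/ord3_ind; rewrite !mxE /= !(mulr0, mulr1, addr0, add0r).
  exact: fermat_field_neq0.
Qed.

End NonfreeExample.

Theorem theorem6p2 (R : realType) :
  exists A B : {fset {vspace 'rV[R[i]%C]_3}},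
    [/\ line_arrangement A, line_arrangement B,
        same_weak_combinatorics A B,
        free_arrangement A & ~ free_arrangement B].
Proof.
have [z pz] := exists_primitive_5root R.
have hA := tri_line_family (free_roots_uniq R) (free_roots_neq0 R).
have hB := tri_line_family (fifth_roots_uniq pz) (fifth_roots_neq0 pz).
exists (arrangement (tri_lines (free_roots R))), (arrangement (tri_lines (fifth_roots z))).
split; [exact: arrangement_lines|exact: arrangement_lines| |exact: free_example|].
  have [pA rA] := free_roots_counts R; have [pB rB] := fifth_roots_counts pz.
  apply: tri_same_weak_combinatorics; rewrite ?pA ?rA ?pB ?rB //.
  - exact: free_roots_uniq.
  - exact: free_roots_neq0.
  - exact: fifth_roots_uniq.
  - exact: fifth_roots_neq0.
exact: nonfree_example.
Qed.
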